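(* Let $\mathcal{H}=\mathcal{H}(\Omega)$ be a functional (reproducing kernel) Hilbert space on a nonempty set $\Omega$ and let $A\in\mathcal{B}(\mathcal{H})$. Let $g,h$ be nonnegative continuous functions on $[0,\infty)$ satisfying $g(s)h(s)=s$ for all $s\ge0$. Then for any Orlicz function $\phi$ and any $\alpha\in[0,1]$, $$\phi\left(\mathbf{ber}^2(A)\right)\le\mathbf{ber}\left(\frac{\alpha}{2}\left(\phi\left(g^4(|A|)\right)+\phi\left(h^4(|A^*|)\right)\right)+(1-\alpha)\,\phi\left(|A|^2\right)\right)$$ and $$\phi\left(\mathbf{ber}^2(A)\right)\le\mathbf{ber}\left(\frac{\alpha}{2}\left(\phi\left(g^4(|A^*|)\right)+\phi\left(h^4(|A|)\right)\right)+(1-\alpha)\,\phi\left(|A^*|^2\right)\right).$$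
   Context: A functional (reproducing kernel) Hilbert space $\mathcal{H}=\mathcal{H}(\Omega)$ is a Hilbert space of complex-valued functions on a nonempty set $\Omega$ such that for every $\lambda\in\Omega$ the evaluation $f\mapsto f(\lambda)$ is a continuous linear functional; $k_\lambda\in\mathcal{H}$ is the unique element with $f(\lambda)=\langle f,k_\lambda\rangle$ for all $f\in\mathcal{H}$. It is assumed that $k_\lambda\neq0$ for all $\lambda\in\Omega$, and $\hat{k}_\lambda=k_\lambda/\|k_\lambda\|$ is the normalized reproducing kernel. $\mathcal{B}(\mathcal{H})$ is the algebra of bounded linear operators on $\mathcal{H}$; $|A|=(A^*A)^{1/2}$. The Berezin number of $A\in\mathcal{B}(\mathcal{H})$ is $\mathbf{ber}(A)=\sup_{\lambda\in\Omega}|\langle A\hat{k}_\lambda,\hat{k}_\lambda\rangle|$, and $\mathbf{ber}^p(A)=(\mathbf{ber}(A))^p$. Functions of positive operators are taken in the continuous functional calculus; $g^p(|A|)=(g(|A|))^p$, and similarly for $h$. An Orlicz function is a function $\phi:[0,\infty)\to[0,\infty)$ that is continuous, convex and increasing, with $\phi(0)=0$ and $\phi(t)\to+\infty$ as $t\to+\infty$. *)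

(* Defs.v *)
From HB Require Import structures.
From mathcomp Require Import all_boot all_order all_algebra.
From mathcomp Require Import sesquilinear complex.
From mathcomp Require Import all_classical all_reals all_analysis.

Set Implicit Arguments.
Unset Strict Implicit.
Unset Printing Implicit Defensive.

Import Order.TTheory GRing.Theory Num.Theory.
Import numFieldNormedType.Exports.

Local Open Scope classical_set_scope.
Local Open Scope ring_scope.
Local Open Scope complex_scope.

(* Norms on modules over R[i] take their values in R[i] (on its nonnegative
   real half-line); inner products are linear in the first argument. *)
Record hilbert (R : realType) := Hilbert {
  hilbert_space :> completeNormedModType R[i];
  ip : {dot hilbert_space for Num.conj};
  ip_norm : forall x, ip x x = `|x| ^+ 2 }.

(* Elements are identified with functions on Omega through the injective
   linear map ev. *)
Record rkhs (R : realType) (Omega : Type) := Rkhs {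
  rkhs_hilbert :> hilbert R;
  ev : rkhs_hilbert -> Omega -> R[i];
  ev_linear : forall (a : R[i]) (f g : rkhs_hilbert) (l : Omega),
    ev (a *: f + g) l = a * ev f l + ev g l;
  ev_inj : injective ev;
  ev_continuous : forall l, continuous (fun f => ev f l : R[i]^o) }.

(* Operators are functions H -> H, with the pointwise addition and scaling of
   the library; composition is their product and iter n T the n-th power. *)
Section Operators.
Variables (R : realType) (H : hilbert R).
Implicit Types (A S T : H -> H).

Definition bounded_op T := linear T /\ continuous T.

(* Equal to 0 by convention if there is no adjoint. *)
Definition adj A : H -> H :=
  xget 0 [set B | bounded_op B /\ forall x y, ip H (A x) y = ip H x (B y)].

Definition spectrum T : set R[i] :=
  [set z | ~ exists S, [/\ bounded_op S,
     forall x, S (z *: x - T x) = x & forall x, z *: S x - T (S x) = x]].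

Definition poly_op (p : {poly R}) T : H -> H :=
  fun x => \sum_(i < size p) (p`_i)%:C *: iter i T x.

Definition op_cvg (S_ : nat -> H -> H) S :=
  forall e : R, 0 < e ->
    \forall n \near \oo, forall x, `|S_ n x - S x| <= e%:C * `|x|.

(* Continuous functional calculus f(T) of a self-adjoint T, whose spectrum is
   real: the norm limit of p_n(T) for polynomials p_n converging uniformly to f
   on the spectrum of T. It is 0 by convention if there is no such operator. *)
Definition cfc (f : R -> R) T : H -> H :=
  xget 0 [set S | bounded_op S /\
    exists p_ : nat -> {poly R},
      {uniform [set t : R | spectrum T t%:C],
        (fun n => horner (p_ n)) @ \oo --> f} /\
      op_cvg (fun n => poly_op (p_ n) T) S].

Definition abs_op A : H -> H := cfc Num.sqrt (adj A \o A).

End Operators.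

Section Berezin.
Variables (R : realType) (Omega : Type) (H : rkhs R Omega).

Definition rkernel (l : Omega) : H :=
  xget 0 [set k : H | forall f : H, ev f l = ip H f k].

Definition nrkernel (l : Omega) : H := `|rkernel l|^-1 *: rkernel l.

Definition ber (A : H -> H) : R :=
  sup [set Normc.normc (ip H (A (nrkernel l)) (nrkernel l)) | l in [set: Omega]].

End Berezin.

Record orlicz (R : realType) (phi : R -> R) : Prop := Orlicz {
  orlicz_ge0 : forall t : R, 0 <= t -> 0 <= phi t;
  orlicz_continuous : {within `[0, +oo[, continuous phi};
  orlicz_convex : convex_function (`[0, +oo[ : set R) phi;
  orlicz_increasing : forall s t : R, 0 <= s -> s <= t -> phi s <= phi t;
  orlicz0 : phi 0 = 0;
  orlicz_pinfty : phi t @[t --> +oo] --> +oo }.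

(* Main.v *)
Require Import Defs.
From HB Require Import structures.
From mathcomp Require Import all_boot all_order all_algebra.
From mathcomp Require Import sesquilinear complex ring lra.
From mathcomp Require Import all_classical all_reals all_analysis.

Set Implicit Arguments.
Unset Strict Implicit.
Unset Printing Implicit Defensive.

Import Order.TTheory GRing.Theory Num.Theory.
Import numFieldNormedType.Exports.

Local Open Scope classical_set_scope.
Local Open Scope ring_scope.
Local Open Scope complex_scope.

(** Write [|A|] for the modulus of [A], [A'] for the adjoint of [A], and let [x]
    be a unit vector, in particular a normalized kernel.  The mixed Schwarz inequality
      [|<A x, y>| <= ||g(|A|) x|| ||h(|A'|) y||]
    and the bound [||T x||^4 <= <T^4 x, x>], applied to the selfadjoint operators
    [g(|A|)] and [h(|A'|)], give
      [|<A x, x>|^2 <= (<g(|A|)^4 x, x> + <h(|A'|)^4 x, x>) / 2],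
    while the Cauchy-Schwarz inequality gives [|<A x, x>|^2 <= <|A|^2 x, x>].
    Since [phi] is increasing and convex, and since the operator Jensen inequality
    [phi(<T x, x>) <= <phi(T) x, x>] holds for positive [T] ([orlicz_jensen]),
    [phi(|<A x, x>|^2)] is at most [<S x, x>], [S] being the operator on the
    right-hand side ([orlicz_unit_vector]).  Taking suprema over the kernels, and
    using the continuity of [phi], yields the first inequality ([orlicz_ber]); the
    second one is the first one for the adjoint of [A], which has the same Berezin
    number.

    The mixed Schwarz inequality ([mixed_schwarz]) comes from the intertwining
    [A f(|A|) = f(|A'|) A].  In place of the partial isometry of the polar
    decomposition, it uses the contractions [U = A (|A| + d)^-1]: one has
    [A = U h(|A|) g(|A|) + d U = h(|A'|) U g(|A|) + d U], and [d] tends to [0].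

    The rest is the continuous functional calculus of a positive operator [T].
    - A selfadjoint operator that is coercive is invertible ([coercive_inverse]),
      by minimization of a quadratic functional; this also gives adjoints, and
      shows that the spectrum of [T] lies in a segment [[0, M]].
    - For selfadjoint [T], [||p(T)||] is at most the supremum of [|p|] on the
      spectrum ([poly_op_bound]): if [N] is the norm of [p(T)], then
      [N^2 - p(T)^2] is not bounded below, so one of the factors of the polynomial
      [N^2 - p^2] over the complex numbers yields a point of the spectrum at which
      [|p|] equals [N].
    - Polynomials are dense on segments ([weierstrass], by Bernstein polynomials),
      so the calculus exists and is the limit of [p_n(T)] along every approximation
      of [f] on [[0, M]] ([cfc_cvg]).  Multiplicativity, positivity and
      intertwining follow by passing to the limit. *)

(** * Hilbert spaces through a real norm and a real inner product *)

Section HilbertGeometry.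
Variables (R : realType) (H : hilbert R).
Implicit Types (x y z : H) (a : R[i]) (c : R).

(** The norm as a real number. *)
Definition hnorm x : R := complex.Re `|x|.

(** The real inner product underlying the complex one. *)
Definition rdot x y : R := complex.Re (ip H x y).

Lemma hnormE x : `|x| = (hnorm x)%:C.
Proof. by rewrite /hnorm RRe_real // ger0_real. Qed.

Lemma hnorm_ge0 x : 0 <= hnorm x.
Proof. by rewrite -ler0c -hnormE. Qed.

Lemma hnorm0 : hnorm 0 = 0.
Proof. by rewrite /hnorm normr0. Qed.

Lemma hnorm0_eq0 x : hnorm x = 0 -> x = 0.
Proof. by move=> x0; apply/normr0_eq0; rewrite hnormE x0. Qed.

Lemma hnorm_gt0 x : (0 < hnorm x) = (x != 0).
Proof. by rewrite -ltcR -hnormE normr_gt0. Qed.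

Lemma ler_hnormD x y : hnorm (x + y) <= hnorm x + hnorm y.
Proof. by rewrite -lecR rmorphD /= -!hnormE ler_normD. Qed.

Lemma hnorm_opp x : hnorm (- x) = hnorm x.
Proof. by rewrite /hnorm normrN. Qed.

Lemma hdistC x y : hnorm (x - y) = hnorm (y - x).
Proof. by rewrite -hnorm_opp opprB. Qed.

Lemma ler_hdistD z x y : hnorm (x - y) <= hnorm (x - z) + hnorm (z - y).
Proof. by have := ler_hnormD (x - z) (z - y); rewrite addrA subrK. Qed.

Lemma hnormZ a x : hnorm (a *: x) = Normc.normc a * hnorm x.
Proof. by apply: complexI; rewrite -hnormE normrZ hnormE rmorphM. Qed.

Lemma normcR c : Normc.normc c%:C = `|c|.
Proof. by rewrite /= expr0n addr0 sqrtr_sqr. Qed.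

Lemma hnormZr c x : hnorm (c%:C *: x) = `|c| * hnorm x.
Proof. by rewrite hnormZ normcR. Qed.

Lemma ipDl x y z : ip H (x + y) z = ip H x z + ip H y z.
Proof. exact: linearDl. Qed.

Lemma ipDr x y z : ip H x (y + z) = ip H x y + ip H x z.
Proof. exact: linearDr. Qed.

Lemma ipZl a x y : ip H (a *: x) y = a * ip H x y.
Proof. exact: linearZl_LR. Qed.

Lemma ipZr a x y : ip H x (a *: y) = a^* * ip H x y.
Proof. exact: linearZr_LR. Qed.

Lemma ipC x y : ip H x y = (ip H y x)^*.
Proof. by rewrite hermC /= expr0 mul1r. Qed.

Lemma rdotDl x y z : rdot (x + y) z = rdot x z + rdot y z.
Proof. by rewrite /rdot ipDl raddfD. Qed.

Lemma rdotDr x y z : rdot x (y + z) = rdot x y + rdot x z.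
Proof. by rewrite /rdot ipDr raddfD. Qed.

Lemma rdotZl c x y : rdot (c%:C *: x) y = c * rdot x y.
Proof. by rewrite /rdot ipZl; case: (ip H x y) => u v; rewrite /= mul0r subr0. Qed.

Lemma rdotC x y : rdot x y = rdot y x.
Proof. by rewrite /rdot ipC; case: (ip H y x). Qed.

Lemma rdotZr c x y : rdot x (c%:C *: y) = c * rdot x y.
Proof. by rewrite rdotC rdotZl rdotC. Qed.

Lemma rdotNl x y : rdot (- x) y = - rdot x y.
Proof.
have -> : - x = (-1)%:C *: x by rewrite rmorphN scaleN1r.
by rewrite rdotZl mulN1r.
Qed.

Lemma rdotNr x y : rdot x (- y) = - rdot x y.
Proof. by rewrite rdotC rdotNl rdotC. Qed.

Lemma rdot0l y : rdot 0 y = 0.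
Proof. by have := rdotNl 0 y; rewrite oppr0; lra. Qed.

Lemma rdotxx x : rdot x x = hnorm x ^+ 2.
Proof. by rewrite /rdot ip_norm hnormE -rmorphXn. Qed.

Definition rdotE := (rdotDl, rdotDr, rdotNl, rdotNr, rdotZl, rdotZr).

Lemma hnormD_sqr x y :
  hnorm (x + y) ^+ 2 = hnorm x ^+ 2 + 2 * rdot x y + hnorm y ^+ 2.
Proof. by rewrite -!rdotxx !rdotE (rdotC y x); ring. Qed.

Lemma ler_rdot x y : rdot x y <= hnorm x * hnorm y.
Proof.
have [/hnorm0_eq0 ->|x0] := eqVneq (hnorm x) 0.
  by rewrite rdot0l hnorm0 mul0r.
have [/hnorm0_eq0 ->|y0] := eqVneq (hnorm y) 0.
  by rewrite rdotC rdot0l hnorm0 mulr0.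
have := sqr_ge0 (hnorm ((hnorm y)%:C *: x - (hnorm x)%:C *: y)).
rewrite hnormD_sqr hnorm_opp !hnormZr !rdotE.
have := hnorm_ge0 x; rewrite le0r (negPf x0) /= => {}x0.
have := hnorm_ge0 y; rewrite le0r (negPf y0) /= => {}y0.
rewrite !gtr0_norm // => le0; rewrite -subr_ge0 -(pmulr_rge0 _ (mulr_gt0 x0 y0)).
by rewrite -(pmulr_rge0 _ (ltr0n R 2)); apply: le_trans le0 _; lra.
Qed.

Lemma ler_norm_rdot x y : `|rdot x y| <= hnorm x * hnorm y.
Proof.
by rewrite ler_norml ler_rdot andbT lerNl -rdotNl (le_trans (ler_rdot _ _))// hnorm_opp.
Qed.

(** Rotating the first argument turns the modulus of an inner product into a real
    part; inequalities on [rdot] thus extend to moduli. *)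
Lemma normc_ip x y :
  Normc.normc (ip H x y) ^+ 2 = rdot ((ip H x y)^* *: x) y.
Proof.
rewrite /rdot ipZl; case: (ip H x y) => u v /=.
by rewrite sqr_sqrtr ?addr_ge0 ?sqr_ge0 //; ring.
Qed.

Lemma rdot_le_normc x y : rdot x y <= Normc.normc (ip H x y).
Proof.
rewrite /rdot; case: (ip H x y) => u v /=.
rewrite (le_trans (ler_norm _))// -sqrtr_sqr ler_wsqrtr // lerDl sqr_ge0 //.
Qed.

Lemma normc_conj (a : R[i]) : Normc.normc a^* = Normc.normc a.
Proof. by case: a => u v /=; rewrite sqrrN. Qed.

Lemma normc_ge0 (a : R[i]) : 0 <= Normc.normc a.
Proof. by case: a => u v; exact: sqrtr_ge0. Qed.

Lemma ler_normc_ip x y : Normc.normc (ip H x y) <= hnorm x * hnorm y.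
Proof.
have [->|a0] := eqVneq (Normc.normc (ip H x y)) 0.
  by rewrite mulr_ge0 ?hnorm_ge0.
have a_gt0 : 0 < Normc.normc (ip H x y) by rewrite lt_neqAle eq_sym a0 normc_ge0.
rewrite -(ler_pM2l a_gt0) -expr2 normc_ip (le_trans (ler_rdot _ _))//.
by rewrite hnormZ normc_conj mulrA.
Qed.

(** The real parts of all rotations determine a complex inner product. *)
Lemma rdot_ip (x y x' y' : H) :
  (forall a, rdot (a *: x) y = rdot (a *: x') y') -> ip H x y = ip H x' y'.
Proof.
move=> eq_r; have := eq_r 1; have := eq_r 'i; rewrite /rdot !ipZl !mul1r.
case: (ip H x y) (ip H x' y') => [u v] [u' v'] /=.
by rewrite !mul0r !mul1r !sub0r => /oppr_inj -> ->.
Qed.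

Lemma hilbert_complete (u : nat -> H) :
  (forall e : R, 0 < e -> exists N, forall m n, (N <= m)%N -> (N <= n)%N ->
     hnorm (u m - u n) <= e) ->
  exists l, forall e : R, 0 < e -> exists N, forall n, (N <= n)%N ->
     hnorm (u n - l) <= e.
Proof.
move=> u_cauchy.
have : cvg (u @ \oo).
  apply/cauchy_cvgP/cauchy_exP => e; rewrite ltcE /= => /andP[/eqP e_im e_gt0].
  have e2_gt0 : 0 < complex.Re e / 2 by rewrite divr_gt0.
  have [N uN] := u_cauchy _ e2_gt0.
  exists (u N); exists N => // n /= Nn; rewrite -ball_normE /=.
  rewrite hnormE ltcE /= e_im eqxx /= (le_lt_trans (uN _ _ _ _)) //.
  by rewrite ltr_pdivrMr // ltr_pMr // ltr1n.
move=> /cvg_ex[l ul]; exists l => e e_gt0.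
have /cvgrPdist_le/(_ e%:C) := ul; rewrite ltcR => /(_ e_gt0)[N _ uN].
by exists N => n Nn; rewrite hdistC -lecR -hnormE; exact: uN.
Qed.

End HilbertGeometry.

(** * Bounded operators *)

Section BoundedOperators.
Variables (R : realType) (H : hilbert R).
Implicit Types (S T : H -> H) (x y : H).

Lemma linear_opD T : linear T -> {morph T : x y / x + y}.
Proof. by move=> linT x y; have := linT 1 x y; rewrite !scale1r. Qed.

Lemma linear_op0 T : linear T -> T 0 = 0.
Proof. by move=> linT; apply: (addIr (T 0)); rewrite -linear_opD // !add0r. Qed.

Lemma linear_opZ T a : linear T -> {morph T : x / a *: x}.
Proof. by move=> linT x; have := linT a x 0; rewrite (linear_op0 linT) !addr0. Qed.

Lemma linear_opN T : linear T -> {morph T : x / - x}.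
Proof. by move=> linT x; rewrite -scaleN1r linear_opZ // scaleN1r. Qed.

Lemma linear_opB T : linear T -> {morph T : x y / x - y}.
Proof. by move=> linT x y; rewrite linear_opD // linear_opN. Qed.

(** [M] bounds the operator norm of [T]. *)
Definition op_bound T (M : R) := forall x, hnorm (T x) <= M * hnorm x.

Lemma op_bound_continuous T (M : R) : linear T -> op_bound T M -> continuous T.
Proof.
move=> linT T_le x; apply/cvgrPdist_le => /= e; rewrite ltcE /= => /andP[/eqP e_im e_gt0].
have M1_gt0 : 0 < `|M| + 1 by rewrite ltr_wpDl.
near=> z.
rewrite -linear_opB // hnormE lecE /= e_im eqxx /= (le_trans (T_le _)) //.
rewrite (@le_trans _ _ ((`|M| + 1) * hnorm (x - z))) //.
  rewrite ler_wpM2r ?hnorm_ge0 // (le_trans (ler_norm _)) // lerDl //.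
rewrite mulrC -ler_pdivlMr // -lecR -hnormE.
near: z; apply: cvgr_dist_le; first exact: cvg_id.
by rewrite ltcR divr_gt0.
Unshelve. all: by end_near. Qed.

Lemma bounded_opP T : bounded_op T -> exists2 M : R, 0 <= M & op_bound T M.
Proof.
case=> linT /(_ 0); rewrite /continuous_at (linear_op0 linT).
move=> /cvgrPdist_le/(_ 1%:C); rewrite ltcR => /(_ ltr01).
move=> /nbhs_normP[/= d]; rewrite ltcE /= => /andP[/eqP d_im d_gt0] Td.
set r := complex.Re d in d_gt0.
have Tr x : hnorm x < r -> hnorm (T x) <= 1.
  move=> xr; have := Td x; rewrite /= !sub0r !normrN !hnormE lecR; apply.
  by rewrite ltcE /= d_im eqxx.
exists (2 / r); first by rewrite divr_ge0 // ltW.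
move=> x; have [->|x0] := eqVneq x 0.
  by rewrite (linear_op0 linT) hnorm0 mulr0.
have x_gt0 : 0 < hnorm x by rewrite hnorm_gt0.
have c_gt0 : 0 < r / (2 * hnorm x) by rewrite divr_gt0 ?mulr_gt0.
have := Tr ((r / (2 * hnorm x))%:C *: x).
rewrite linear_opZ // !hnormZr gtr0_norm // invfM !mulrA mulfVK ?gt_eqF //.
have -> : r / 2 < r by rewrite ltr_pdivrMr // ltr_pMr // ltr1n.
move=> /(_ isT); rewrite mulrAC ler_pdivrMr // mul1r -ler_pdivlMl ?divr_gt0 //.
by rewrite invf_div.
Qed.

End BoundedOperators.

(** * Coercive operators, inverses and adjoints *)

Lemma natSinv_small (R : realType) (d : R) : 0 < d ->
  exists N, forall n, (N <= n)%N -> n.+1%:R^-1 <= d.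
Proof.
move=> d0; have [N _ Nd] := near_infty_natSinv_lt (PosNum d0).
by exists N => n Nn; exact/ltW/Nd.
Qed.

Section Coercive.
Variables (R : realType) (H : hilbert R).
Implicit Types (x y z w : H).

(** Bounded and symmetric; for linear [T], symmetry for the real inner product is
    equivalent to symmetry for the complex one. *)
Definition selfadjoint (T : H -> H) :=
  bounded_op T /\ forall x y, rdot (T x) y = rdot x (T y).

Lemma rdot_inj x y : (forall z, rdot x z = rdot y z) -> x = y.
Proof.
move=> eq_xy; apply/eqP; rewrite -subr_eq0; apply/eqP/hnorm0_eq0/eqP.
by rewrite -sqrf_eq0 -rdotxx rdotDl rdotNl eq_xy subrr.
Qed.

(** Lax-Milgram for symmetric operators.  The solution minimizes
    [J x = <T x, x> - 2 f x]: minimizing sequences are Cauchy by the parallelogram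
    identity, and the derivative of [J] tends to [0] along them. *)
Lemma coercive_functional (T : H -> H) (c : R) (f : H -> R) (K : R) :
  selfadjoint T -> 0 < c -> (forall x, c * hnorm x ^+ 2 <= rdot (T x) x) ->
  (forall x y, f (x + y) = f x + f y) ->
  (forall (a : R) x, f (a%:C *: x) = a * f x) ->
  (forall x, f x <= K * hnorm x) ->
  exists x, forall y, rdot (T x) y = f y.
Proof.
move=> [bT symT] c_gt0 T_ge fD fZ f_le.
have linT := bT.1; have [M M0 T_le] := bounded_opP bT.
pose J x := rdot (T x) x - 2 * f x.
have J_ge x : - (K ^+ 2 / c) <= J x.
  apply: (@le_trans _ _ (c * hnorm x ^+ 2 - 2 * (K * hnorm x))).
    rewrite -(ler_pM2l c_gt0) mulrN mulrC divfK ?gt_eqF //.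
    by have := sqr_ge0 (c * hnorm x - K); lra.
  by rewrite lerB // ler_pM2l.
have J_inf : has_inf (range J).
  split; first by exists (J 0), 0.
  by exists (- (K ^+ 2 / c)) => _ [x _ <-].
pose m := inf (range J).
have J_m x : m <= J x by apply: ge_inf; [exact: J_inf.2|exists x].
have /choice[u Ju] : forall n : nat, exists x, J x < m + n.+1%:R^-1.
  move=> n; have n_gt0 : 0 < n.+1%:R^-1 :> R by rewrite invr_gt0.
  by have [_ [x _ <-] Jx] := inf_adherent n_gt0 J_inf; exists x.
have JD x y (t : R) :
    J (x + t%:C *: y) = J x + 2 * t * (rdot (T x) y - f y) + t ^+ 2 * rdot (T y) y.
  rewrite /J linear_opD // linear_opZ // fD fZ !rdotE (symT y x) (rdotC y).
  by ring.
have D_le y n : (rdot (T (u n)) y - f y) ^+ 2 <= rdot (T y) y * n.+1%:R^-1.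
  (* the step that minimizes J on the line through u n directed by y *)
  have := J_m (u n + (- (rdot (T (u n)) y - f y) / rdot (T y) y)%:C *: y).
  have [->|y0] := eqVneq y 0.
    have f0 : f 0 = 0 by have := fD 0 0; rewrite addr0; lra.
    by rewrite f0 rdotC !rdot0l rdotC rdot0l subrr expr0n mul0r.
  have Q_gt0 : 0 < rdot (T y) y.
    by rewrite (lt_le_trans _ (T_ge y)) // mulr_gt0 // exprn_gt0 // hnorm_gt0.
  rewrite JD => le_m.
  set D := rdot (T (u n)) y - f y in le_m *; set Q := rdot (T y) y in Q_gt0 le_m *.
  have {}le_m : m <= J (u n) - D ^+ 2 / Q.
    apply: le_trans le_m _; rewrite le_eqVlt; apply/orP; left; apply/eqP.
    by field; rewrite gt_eqF.
  rewrite mulrC -ler_pdivrMr //.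
  by move: (Ju n); move: (n.+1%:R^-1) le_m => d le_m; lra.
have [l ul] : exists l, forall e : R, 0 < e -> exists N, forall n, (N <= n)%N ->
    hnorm (u n - l) <= e.
  apply: hilbert_complete => e e_gt0.
  have d_gt0 : 0 < c * e ^+ 2 / 4 by rewrite divr_gt0 ?mulr_gt0 ?exprn_gt0.
  have [N Nd] := natSinv_small d_gt0; exists N => i n Ni Nn.
  (* J at the end and at the midpoint of the segment from u n to u i *)
  have E1 := JD (u n) (u i - u n) 1; have E2 := JD (u n) (u i - u n) 2^-1.
  rewrite rmorph1 scale1r (addrC (u n)) subrK in E1.
  have := J_m (u n + (2^-1)%:C *: (u i - u n)); rewrite E2.
  have := T_ge (u i - u n).
  have := Ju i; have := Ju n; have := Nd _ Ni; have := Nd _ Nn; rewrite E1.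
  move: (n.+1%:R^-1) (i.+1%:R^-1) => dn di Jn Ji Hdn Hdi Tge le_m.
  have {}Tge : c * hnorm (u i - u n) ^+ 2 <= c * e ^+ 2 by lra.
  rewrite -ler_sqr ?nnegrE ?hnorm_ge0 ?(ltW e_gt0) //.
  by rewrite -(ler_pM2l c_gt0).
exists l => y; apply/eqP; rewrite -subr_eq0; apply/negPn/negP => D_neq0.
set D := _ - _ in D_neq0.
have D_gt0 : 0 < `|D| by rewrite normr_gt0.
have Q_ge0 z : 0 <= rdot (T z) z.
  by apply: le_trans (T_ge z); rewrite mulr_ge0 ?sqr_ge0 // ltW.
(* D is approximated by its value at u n, which tends to 0. *)
pose B := M * hnorm y + 1.
have B_gt0 : 0 < B by rewrite ltr_wpDl // mulr_ge0 ?hnorm_ge0.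
have [N1 ulN] := ul _ (divr_gt0 D_gt0 (mulr_gt0 (ltr0Sn R 1) B_gt0)).
have d_gt0 : 0 < D ^+ 2 / (8 * (rdot (T y) y + 1)).
  by rewrite divr_gt0 ?exprn_even_gt0 // mulr_gt0 // ltr_wpDl.
have [N2 N2d] := natSinv_small d_gt0.
pose n := maxn N1 N2.
have := ulN n (leq_maxl _ _); have := N2d n (leq_maxr _ _).
move=> n_le un_le; have := D_le y n; set Dn := _ - _ => Dn_le.
have DB : `|D| <= `|Dn| + `|D| / 2.
  have DE : D = Dn - rdot (T (u n - l)) y.
    by rewrite linear_opB // !rdotE /D /Dn; ring.
  rewrite {1}DE (le_trans (ler_normB _ _)) // lerD2l (le_trans (ler_norm_rdot _ _)) //.
  apply: (@le_trans _ _ (B * hnorm (u n - l))).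
    rewrite mulrC (le_trans (ler_wpM2l (hnorm_ge0 _) (T_le _))) //.
    by rewrite mulrA ler_wpM2r ?hnorm_ge0 // (mulrC (hnorm y)) lerDl.
  rewrite -ler_pdivlMl // (le_trans un_le) //.
  suff -> : `|D| / (2 * B) = B^-1 * (`|D| / 2) by [].
  by field; rewrite gt_eqF.
have : Dn ^+ 2 <= D ^+ 2 / 8.
  apply: le_trans Dn_le _.
  apply: (@le_trans _ _ ((rdot (T y) y + 1) * n.+1%:R^-1)).
    by rewrite ler_wpM2r ?invr_ge0 // lerDl.
  have Q1_gt0 : 0 < rdot (T y) y + 1 by rewrite ltr_wpDl.
  rewrite -ler_pdivlMl // (le_trans n_le) //.
  set q := _ + 1 in Q1_gt0 *.
  suff -> : D ^+ 2 / (8 * q) = q^-1 * (D ^+ 2 / 8) by [].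
  by field; rewrite gt_eqF.
rewrite -(real_normK (num_real Dn)) -(real_normK (num_real D)) => Dn2.
have : (`|D| / 2) ^+ 2 <= `|Dn| ^+ 2 by rewrite ler_sqr ?nnegrE ?divr_ge0 //; lra.
have : 0 < `|D| ^+ 2 by rewrite exprn_gt0.
by rewrite expr_div_n; lra.
Qed.

Lemma coercive_inverse (T : H -> H) (c : R) :
  selfadjoint T -> 0 < c -> (forall x, c * hnorm x ^+ 2 <= rdot (T x) x) ->
  exists2 V, bounded_op V & cancel T V /\ cancel V T.
Proof.
move=> saT c_gt0 T_ge; have linT := saT.1.1.
have T_below x : c * hnorm x <= hnorm (T x).
  have [->|x0] := eqVneq x 0; first by rewrite hnorm0 mulr0 hnorm_ge0.
  have x_gt0 : 0 < hnorm x by rewrite hnorm_gt0.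
  rewrite -(ler_pM2r x_gt0) -mulrA -expr2 (le_trans (T_ge x)) //.
  exact: ler_rdot.
have T_inj : injective T.
  move=> x y Txy; apply/eqP; rewrite -subr_eq0; apply/eqP/hnorm0_eq0/eqP.
  have := T_below (x - y); rewrite linear_opB // Txy subrr hnorm0.
  by rewrite pmulr_rle0 // eq_le hnorm_ge0 andbT.
have /choice[V TV] : forall w, exists x, T x = w.
  move=> w; have [x Tx] := coercive_functional (f := rdot w) saT c_gt0 T_ge
    (rdotDr w) (fun a x => rdotZr a w x) (ler_rdot w).
  by exists x; exact: rdot_inj.
exists V; last by split=> // x; apply: T_inj.
have linV : linear V.
  by move=> a x y; apply: T_inj; rewrite (linear_opD linT) (linear_opZ _ linT) !TV.
split=> //; apply: (@op_bound_continuous _ _ _ c^-1) => // x.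
by rewrite ler_pdivlMl // -{2}(TV x).
Qed.

Lemma selfadjoint_id : selfadjoint id.
Proof. by split=> //; split=> // x; exact: cvg_id. Qed.

(** [B] is a bounded adjoint of [A]. *)
Definition is_adjoint (A B : H -> H) :=
  bounded_op B /\ forall x y, ip H (A x) y = ip H x (B y).

(** Riesz representation of the functionals [<A z, y>], which is
    [coercive_functional] for the identity operator. *)
Lemma adjoint_exists (A : H -> H) : bounded_op A -> exists B, is_adjoint A B.
Proof.
move=> bA; have linA := bA.1; have [M M0 A_le] := bounded_opP bA.
have id_ge x : 1 * hnorm x ^+ 2 <= rdot (id x) x by rewrite rdotxx mul1r.
have /choice[B AB] : forall y, exists x, forall z, rdot x z = rdot (A z) y.
  move=> y; apply: (coercive_functional (f := fun z => rdot (A z) y)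
    (K := M * hnorm y) selfadjoint_id ltr01 id_ge) => [x z|a x|x].
  - by rewrite linear_opD // rdotDl.
  - by rewrite linear_opZ // rdotZl.
  - rewrite (le_trans (ler_rdot _ _)) // mulrAC.
    by rewrite ler_wpM2r ?hnorm_ge0.
have ipAB x y : ip H (A x) y = ip H x (B y).
  by apply: rdot_ip => a; rewrite -(linear_opZ _ linA) -AB rdotC.
have linB : linear B.
  move=> a x y; apply: rdot_inj => z.
  rewrite /rdot (ipC (B _)) (ipC (_ + _)) -ipAB.
  by rewrite !ipDr !ipZr !ipAB.
exists B; split=> //; split=> //; apply: (op_bound_continuous linB (M := M)) => y.
have [->|By0] := eqVneq (B y) 0; first by rewrite hnorm0 mulr_ge0 ?hnorm_ge0.
have By_gt0 : 0 < hnorm (B y) by rewrite hnorm_gt0.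
rewrite -(ler_pM2r By_gt0) -expr2 -rdotxx AB (le_trans (ler_rdot _ _)) //.
by rewrite mulrAC ler_wpM2r ?hnorm_ge0.
Qed.

End Coercive.

(** * Polynomials in an operator *)

Section PolynomialCalculus.
Variables (R : realType) (H : hilbert R).
Implicit Types (T S : H -> H) (x y : H).

(** Polynomials with complex coefficients, needed for factorizations. *)
Definition cpoly_op (p : {poly R[i]}) T x : H :=
  \sum_(i < size p) p`_i *: iter i T x.

Lemma poly_opE (p : {poly R}) T x :
  poly_op p T x = cpoly_op (map_poly (real_complex R) p) T x.
Proof.
rewrite /cpoly_op size_map_poly; apply: eq_bigr => i _.
by rewrite coef_map.
Qed.

Lemma cpoly_op_widen n (p : {poly R[i]}) T x : (size p <= n)%N ->
  cpoly_op p T x = \sum_(i < n) p`_i *: iter i T x.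
Proof.
move=> pn; rewrite /cpoly_op (big_ord_widen _ (fun i => p`_i *: iter i T x) pn).
rewrite [RHS](bigID (fun i : 'I_n => (i < size p)%N)) /= [X in _ = _ + X]big1 ?addr0 //.
by move=> i; rewrite -leqNgt => /(nth_default 0) ->; rewrite scale0r.
Qed.

Lemma cpoly_opD (p q : {poly R[i]}) T x :
  cpoly_op (p + q) T x = cpoly_op p T x + cpoly_op q T x.
Proof.
rewrite !(@cpoly_op_widen (maxn (size p) (size q))) ?leq_maxl ?leq_maxr ?size_polyD //.
rewrite -big_split; apply: eq_bigr => i _; by rewrite coefD scalerDl.
Qed.

Lemma cpoly_opC (c : R[i]) T x : cpoly_op c%:P T x = c *: x.
Proof.
by rewrite (@cpoly_op_widen 1) ?size_polyC ?leq_b1 // big_ord1 coefC.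
Qed.

Lemma cpoly_opMX (p : {poly R[i]}) T x : linear T ->
  cpoly_op (p * 'X) T x = T (cpoly_op p T x).
Proof.
move=> linT; rewrite (@cpoly_op_widen (size p).+1); last first.
  by rewrite (leq_trans (size_polyMleq _ _)) // size_polyX addn2.
rewrite big_ord_recl coefMX eqxx scale0r add0r /cpoly_op.
elim/big_ind2: _ => [|u v u' v' -> ->|i _]; first by rewrite linear_op0.
  by rewrite (linear_opD linT).
by rewrite coefMX /= (linear_opZ _ linT).
Qed.

Lemma cpoly_op_linear (p : {poly R[i]}) T : linear T -> linear (cpoly_op p T).
Proof.
move=> linT a x y; elim/poly_ind: p => [|p c IH].
  by rewrite -polyC0 !cpoly_opC !scale0r scaler0 addr0.
rewrite !cpoly_opD !cpoly_opC !cpoly_opMX // IH (linear_opD linT) (linear_opZ _ linT).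
by rewrite !scalerDr !scalerA (mulrC c) addrACA.
Qed.

Lemma cpoly_opM (p q : {poly R[i]}) T x : linear T ->
  cpoly_op (p * q) T x = cpoly_op p T (cpoly_op q T x).
Proof.
move=> linT; elim/poly_ind: p => [|p c IH].
  by rewrite mul0r -polyC0 !cpoly_opC !scale0r.
rewrite mulrDl mulrAC !cpoly_opD !cpoly_opC !cpoly_opMX // IH; congr (_ + _).
elim/poly_ind: q {IH} => [|q d IH].
  by rewrite mulr0 -polyC0 !cpoly_opC !scale0r scaler0.
rewrite mulrDr mulrA !cpoly_opD !cpoly_opMX // IH -polyCM !cpoly_opC.
by rewrite scalerDr scalerA (linear_opZ _ linT).
Qed.

Lemma poly_opD (p q : {poly R}) T x :
  poly_op (p + q) T x = poly_op p T x + poly_op q T x.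
Proof. by rewrite !poly_opE rmorphD cpoly_opD. Qed.

Lemma poly_opC (c : R) T x : poly_op c%:P T x = c%:C *: x.
Proof. by rewrite poly_opE map_polyC cpoly_opC. Qed.

Lemma poly_opMX (p : {poly R}) T x : linear T ->
  poly_op (p * 'X) T x = T (poly_op p T x).
Proof. by move=> linT; rewrite !poly_opE rmorphM /= map_polyX cpoly_opMX. Qed.

Lemma poly_opX T x : linear T -> poly_op 'X T x = T x.
Proof.
by move=> linT; rewrite -[X in poly_op X]mul1r poly_opMX // -polyC1 poly_opC scale1r.
Qed.

Lemma poly_opM (p q : {poly R}) T x : linear T ->
  poly_op (p * q) T x = poly_op p T (poly_op q T x).
Proof. by move=> linT; rewrite !poly_opE rmorphM cpoly_opM. Qed.

Lemma poly_opZ (c : R) (p : {poly R}) T x : linear T ->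
  poly_op (c *: p) T x = c%:C *: poly_op p T x.
Proof. by move=> linT; rewrite -mul_polyC poly_opM // poly_opC. Qed.

Lemma poly_opN (p : {poly R}) T x : linear T -> poly_op (- p) T x = - poly_op p T x.
Proof. by move=> linT; rewrite -scaleN1r poly_opZ // rmorphN scaleN1r. Qed.

Lemma poly_opB (p q : {poly R}) T x : linear T ->
  poly_op (p - q) T x = poly_op p T x - poly_op q T x.
Proof. by move=> linT; rewrite poly_opD poly_opN. Qed.

Lemma poly_op_linear (p : {poly R}) T : linear T -> linear (poly_op p T).
Proof. by move=> linT a x y; rewrite !poly_opE cpoly_op_linear. Qed.

Lemma poly_op_intertwine (p : {poly R}) (A S T : H -> H) : linear A -> linear S ->
  linear T -> (forall x, A (S x) = T (A x)) ->
  forall x, A (poly_op p S x) = poly_op p T (A x).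
Proof.
move=> linA linS linT AS x; elim/poly_ind: p => [|p c IH].
  by rewrite -polyC0 !poly_opC !scale0r linear_op0.
by rewrite !poly_opD !poly_opC !poly_opMX // (linear_opD linA) (linear_opZ _ linA) AS IH.
Qed.

Lemma bounded_op_continuous T (M : R) : linear T -> op_bound T M -> bounded_op T.
Proof. by move=> linT TM; split=> //; exact: op_bound_continuous TM. Qed.

Lemma selfadjointD S T : selfadjoint S -> selfadjoint T ->
  selfadjoint (fun x => S x + T x).
Proof.
move=> [bS symS] [bT symT]; split=> [|x y]; last by rewrite !rdotE symS symT.
have [M _ S_le] := bounded_opP bS; have [N _ T_le] := bounded_opP bT.
apply: (@bounded_op_continuous _ (M + N)) => [a x y|x].
  by rewrite (linear_opD bS.1) (linear_opD bT.1) (linear_opZ _ bS.1) (linear_opZ _ bT.1)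
    scalerDr addrACA.
by rewrite mulrDl (le_trans (ler_hnormD _ _)) // lerD.
Qed.

Lemma selfadjointZ (c : R) T : selfadjoint T -> selfadjoint (fun x => c%:C *: T x).
Proof.
move=> [bT symT]; split=> [|x y]; last by rewrite !rdotE symT.
have [M _ T_le] := bounded_opP bT.
apply: (@bounded_op_continuous _ (`|c| * M)) => [a x y|x].
  by rewrite (linear_opD bT.1) (linear_opZ _ bT.1) scalerDr !scalerA mulrC.
by rewrite hnormZr -mulrA ler_wpM2l.
Qed.

Lemma bounded_op_comp S T : bounded_op S -> bounded_op T -> bounded_op (S \o T).
Proof.
move=> bS bT; have [M M0 S_le] := bounded_opP bS; have [N _ T_le] := bounded_opP bT.
apply: (@bounded_op_continuous _ (M * N)) => [a x y|x] /=.
  by rewrite (linear_opD bT.1) (linear_opZ _ bT.1) (linear_opD bS.1) (linear_opZ _ bS.1).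
by rewrite (le_trans (S_le _)) // -mulrA ler_wpM2l.
Qed.

Lemma selfadjoint_poly (p : {poly R}) T : selfadjoint T -> selfadjoint (poly_op p T).
Proof.
move=> saT; have [[linT _] symT] := saT; elim/poly_ind: p => [|p c IH].
  rewrite (_ : poly_op 0 T = fun x => 0%:C *: id x).
    by apply: selfadjointZ; exact: selfadjoint_id.
  by apply/funext => x; rewrite -polyC0 poly_opC.
rewrite (_ : poly_op _ T = fun x => T (poly_op p T x) + c%:C *: id x); last first.
  by apply/funext => x; rewrite poly_opD poly_opC poly_opMX.
apply: selfadjointD; last by apply: selfadjointZ; exact: selfadjoint_id.
have [bP symP] := IH.
split; first exact: (bounded_op_comp saT.1 bP).
move=> x y; rewrite symT symP; congr rdot.
by rewrite (poly_op_intertwine _ linT linT linT).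
Qed.

End PolynomialCalculus.

(** * Norms of polynomials in a selfadjoint operator *)

Section Spectrum.
Variables (R : realType) (H : hilbert R).
Implicit Types (T S : H -> H) (x y : H).

(** For linear [T]: injective, with a bounded inverse on the range. *)
Definition bounded_below T := exists2 c : R, 0 < c & forall x, c * hnorm x <= hnorm (T x).

Lemma bounded_below_comp S T :
  bounded_below S -> bounded_below T -> bounded_below (S \o T).
Proof.
move=> [c c0 Sc] [d d0 Td]; exists (c * d); first exact: mulr_gt0.
by move=> x /=; rewrite (le_trans _ (Sc _)) // -mulrA ler_pM2l.
Qed.

Lemma resolvent_bounded_below T (z : R[i]) : ~ spectrum T z ->
  bounded_below (fun x => T x - z *: x).
Proof.
move=> /contrapT[S [bS ST _]]; have [M M0 S_le] := bounded_opP bS.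
have M1_gt0 : 0 < M + 1 by rewrite ltr_wpDl.
exists (M + 1)^-1; rewrite ?invr_gt0 // => x.
rewrite mulrC ler_pdivrMr // mulrC hdistC -{1}(ST x) (le_trans (S_le _)) //.
by rewrite ler_wpM2r ?hnorm_ge0 // lerDl.
Qed.

(** For [z = a + i b] and symmetric [T], [||T x - z x||^2] equals
    [||T x - a x||^2 + b^2 ||x||^2]. *)
Lemma nonreal_bounded_below T (z : R[i]) : selfadjoint T -> complex.Im z != 0 ->
  bounded_below (fun x => T x - z *: x).
Proof.
case: z => a b saT /= b0; exists `|b|; first by rewrite normr_gt0.
pose S y := T y + (- a)%:C *: y.
have [[linS _] symS] : selfadjoint S.
  exact: selfadjointD saT (selfadjointZ (- a) (selfadjoint_id H)).
move=> x.
have -> : T x - (a +i* b) *: x = S x + (- b)%:C *: ('i%C *: x).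
  rewrite /S -addrA scalerA -scalerDl -scaleNr; congr (_ + _ *: _).
  by apply/eqP; rewrite eq_complex /= !(mul0r, mulr0, mulr1, oppr0, add0r, addr0, subr0) !eqxx.
have S0 : rdot (S x) ('i%C *: x) = 0.
  have : rdot (S x) ('i%C *: x) = - rdot (S x) ('i%C *: x).
    rewrite {1}symS (linear_opZ _ linS) rdotC /rdot ipZl ipZr.
    by case: (ip H (S x) x) => u v /=; ring.
  by lra.
rewrite -ler_sqr ?nnegrE ?mulr_ge0 ?hnorm_ge0 // hnormD_sqr rdotZr S0 !mulr0 addr0.
rewrite hnormZr hnormZ normrN (_ : Normc.normc 'i%C = 1) ?mul1r ?lerDr ?sqr_ge0 //.
by rewrite /= expr0n expr1n add0r sqrtr1.
Qed.

Lemma cpoly_prod_bounded_below T (r : seq R[i]) : linear T ->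
  (forall z, z \in r -> bounded_below (fun x => T x - z *: x)) ->
  bounded_below (cpoly_op (\prod_(z <- r) ('X - z%:P)) T).
Proof.
move=> linT; elim: r => [|z r IH] rT.
  by rewrite big_nil; exists 1 => // x; rewrite -polyC1 cpoly_opC scale1r mul1r.
rewrite big_cons.
have -> : cpoly_op (('X - z%:P) * \prod_(j <- r) ('X - j%:P)) T =
    (fun x => T x - z *: x) \o cpoly_op (\prod_(j <- r) ('X - j%:P)) T.
  apply/funext => x; rewrite cpoly_opM //= -polyCN cpoly_opD cpoly_opC scaleNr.
  by rewrite -['X]mul1r cpoly_opMX // -polyC1 cpoly_opC scale1r.
apply: bounded_below_comp; first by apply: rT; rewrite mem_head.
by apply: IH => w wr; apply: rT; rewrite in_cons wr orbT.
Qed.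

(** The factors [T - z] of [p(T)] over the complex numbers are bounded below, [z]
    being either not real or outside the spectrum. *)
Lemma poly_op_bounded_below T (p : {poly R}) : selfadjoint T -> p != 0 ->
  (forall t : R, spectrum T t%:C -> p.[t] != 0) -> bounded_below (poly_op p T).
Proof.
move=> saT p0 pT; have linT := saT.1.1.
set q := map_poly (real_complex R) p.
have q0 : q != 0 by rewrite map_poly_eq0.
have [r qE] := closed_field_poly_normal q.
have [|c c0 rc] := @cpoly_prod_bounded_below T r linT.
  move=> z zr; have [z_im|] := eqVneq (complex.Im z) 0; last exact: nonreal_bounded_below.
  apply: resolvent_bounded_below => zT.
  have zE : z = (complex.Re z)%:C by apply/eqP; rewrite eq_complex /= z_im !eqxx.
  have := pT (complex.Re z); rewrite -zE => /(_ zT)/negP; apply.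
  have : root q z by rewrite qE rootZ ?lead_coef_eq0 // root_prod_XsubC.
  by rewrite /root zE horner_map /= (inj_eq (@complexI R)).
exists (Normc.normc (lead_coef q) * c).
  rewrite mulr_gt0 // lt_neqAle normc_ge0 andbT eq_sym; apply/eqP => /Normc.eq0_normc /eqP.
  by rewrite lead_coef_eq0 (negPf q0).
move=> x; rewrite poly_opE -/q qE -mul_polyC cpoly_opM // cpoly_opC hnormZ -mulrA.
by rewrite mul_polyC -qE ler_wpM2l ?normc_ge0.
Qed.

(** Existence of the operator norm. *)
Lemma least_op_bound S : bounded_op S -> exists2 N : R, 0 <= N & op_bound S N /\
  forall N', 0 <= N' -> op_bound S N' -> N <= N'.
Proof.
move=> bS; have [M M0 S_le] := bounded_opP bS.
pose E := [set N : R | 0 <= N /\ op_bound S N].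
have E_inf : has_inf E by split; [exists M | exists 0 => N []].
exists (inf E); first by apply: lb_le_inf; [exact: E_inf.1 | move=> N []].
split=> [x|N' N'0 N'S]; last by apply: ge_inf; [exact: E_inf.2|].
have [->|x0] := eqVneq x 0; first by rewrite (linear_op0 bS.1) !hnorm0 mulr0.
rewrite -ler_pdivrMr ?hnorm_gt0 //; apply: lb_le_inf; first exact: E_inf.1.
by move=> N [N0 NS]; rewrite ler_pdivrMr ?hnorm_gt0.
Qed.

(** A lower bound [c] of [N^2 - S^2] gives
    [||S x||^2 <= (N^2 - c^2 / N^2) ||x||^2], so that [N] is not the norm of [S]. *)
Lemma smaller_op_bound S (N : R) : selfadjoint S -> 0 < N -> op_bound S N ->
  bounded_below (fun x => (N ^+ 2)%:C *: x - S (S x)) ->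
  exists N', [/\ 0 <= N', N' < N & op_bound S N'].
Proof.
move=> [bS symS] N0 S_le [c c0 Sc].
pose d := N ^+ 2 - c ^+ 2 / N ^+ 2.
have N2_gt0 : 0 < N ^+ 2 by rewrite exprn_gt0.
have Sd x : hnorm (S x) ^+ 2 <= d * hnorm x ^+ 2.
  have : (c * hnorm x) ^+ 2 <= hnorm ((N ^+ 2)%:C *: x - S (S x)) ^+ 2.
    by rewrite ler_sqr ?nnegrE ?hnorm_ge0 ?mulr_ge0 ?hnorm_ge0 // ltW.
  rewrite hnormD_sqr rdotNr rdotZl hnorm_opp hnormZr (ger0_norm (ltW N2_gt0)) -symS rdotxx.
  have : hnorm (S (S x)) ^+ 2 <= N ^+ 2 * hnorm (S x) ^+ 2.
    by rewrite -exprMn ler_sqr ?nnegrE ?hnorm_ge0 ?mulr_ge0 ?hnorm_ge0 // ltW.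
  move=> SS_le le1; rewrite -(ler_pM2l N2_gt0) /d.
  have -> : N ^+ 2 * ((N ^+ 2 - c ^+ 2 / N ^+ 2) * hnorm x ^+ 2) =
      N ^+ 2 * (N ^+ 2 * hnorm x ^+ 2) - c ^+ 2 * hnorm x ^+ 2.
    by field; rewrite gt_eqF.
  by rewrite !exprMn in le1; lra.
have dN : d < N ^+ 2 by rewrite /d gtrBl divr_gt0 // exprn_gt0.
exists (Num.sqrt d); split; first exact: sqrtr_ge0.
  by rewrite -(gtr0_norm N0) -sqrtr_sqr ltr_sqrt.
move=> x; have [d_ge0|d_lt0] := leP 0 d.
  by rewrite -ler_sqr ?nnegrE ?mulr_ge0 ?hnorm_ge0 ?sqrtr_ge0 // exprMn sqr_sqrtr.
have : hnorm (S x) ^+ 2 <= 0.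
  by rewrite (le_trans (Sd x)) // mulr_le0_ge0 ?sqr_ge0 // ltW.
by rewrite exprn_even_le0 //= => /eqP ->; rewrite mulr_ge0 ?hnorm_ge0 ?sqrtr_ge0.
Qed.

(** Either [T] is [0] and [0] is in the spectrum, or the polynomial [N^2 - X^2],
    with [N] the norm of [T], has a zero on the spectrum. *)
Lemma spectrum_nonempty T x : selfadjoint T -> x != 0 -> exists t : R, spectrum T t%:C.
Proof.
move=> saT x0; have linT := saT.1.1; apply: contrapT => /forallNP T_empty.
have [N N0 [N_le N_min]] := least_op_bound saT.1.
have [N_eq0|N_neq0] := eqVneq N 0.
  apply: (T_empty 0) => -[S [bS ST _]]; move/eqP: x0; apply.
  rewrite -(ST x) scale0r sub0r (_ : T x = 0) ?oppr0 ?(linear_op0 bS.1) //.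
  apply: hnorm0_eq0; apply/eqP; rewrite eq_le hnorm_ge0 andbT.
  by rewrite (le_trans (N_le x)) // N_eq0 mul0r.
have N_gt0 : 0 < N by rewrite lt_neqAle eq_sym N_neq0.
have [] := smaller_op_bound saT N_gt0 N_le.
  have -> : (fun x => (N ^+ 2)%:C *: x - T (T x)) = poly_op ((N ^+ 2)%:P - 'X * 'X) T.
    by apply/funext => y; rewrite poly_opB // poly_opC poly_opM // !poly_opX.
  apply: poly_op_bounded_below => // [|t /T_empty//].
  rewrite -size_poly_eq0 addrC size_polyDl ?size_polyN -?expr2 ?size_polyXn //.
  by rewrite (leq_ltn_trans (size_polyC_leq1 _)).
move=> N' [N'0 N'N N'_le]; have := N_min _ N'0 N'_le.
by rewrite leNgt N'N.
Qed.

Theorem poly_op_bound T (p : {poly R}) (e : R) : selfadjoint T -> 0 <= e ->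
  (forall t : R, spectrum T t%:C -> `|p.[t]| <= e) -> op_bound (poly_op p T) e.
Proof.
move=> saT e0 pT; have linT := saT.1.1.
have saP := selfadjoint_poly p saT.
have [N N0 [N_le N_min]] := least_op_bound saP.1.
have [Ne|eN] := leP N e.
  by move=> x; rewrite (le_trans (N_le x)) // ler_wpM2r ?hnorm_ge0.
have [[x x0]|H0] := pselect (exists x : H, x != 0); last first.
  move=> x; have -> : x = 0 by apply/eqP/negPn/negP => x0; apply: H0; exists x.
  by rewrite (linear_op0 saP.1.1) hnorm0 mulr0.
have N_gt0 := le_lt_trans e0 eN.
have pN t : spectrum T t%:C -> ((N ^+ 2)%:P - p * p).[t] != 0.
  move=> /pT pt; rewrite !hornerE subr_eq0 -expr2; apply/eqP => Np.
  have : `|p.[t]| = N.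
    by apply/eqP; rewrite -(@eqrXn2 _ 2) // real_normK ?num_real // -Np.
  by move=> E; rewrite E leNgt eN in pt.
(* the polynomial may be constant, hence the need for a point of the spectrum *)
have q0 : (N ^+ 2)%:P - p * p != 0.
  have [t /pN] := spectrum_nonempty saT x0.
  by apply: contra => /eqP ->; rewrite horner0.
have [] := smaller_op_bound saP N_gt0 N_le.
  have -> : (fun x => (N ^+ 2)%:C *: x - poly_op p T (poly_op p T x)) =
      poly_op ((N ^+ 2)%:P - p * p) T.
    by apply/funext => y; rewrite poly_opB // poly_opC poly_opM.
  exact: poly_op_bounded_below.
move=> N' [N'0 N'N N'_le]; have := N_min _ N'0 N'_le.
by rewrite leNgt N'N.
Qed.

(** Selfadjoint with a nonnegative quadratic form. *)
Definition positive_op T := selfadjoint T /\ forall x, 0 <= rdot (T x) x.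

Lemma spectrum_positive T (M t : R) : positive_op T -> op_bound T M ->
  spectrum T t%:C -> 0 <= t <= M.
Proof.
move=> [saT T_ge0] T_le; have linT := saT.1.1.
move=> T_t; apply: contrapT => /negP; rewrite negb_and -!ltNge => /orP[t_lt0|M_lt].
  have nt_gt0 : 0 < - t by rewrite oppr_gt0.
  have saS := selfadjointD saT (selfadjointZ (- t) (selfadjoint_id H)).
  have [|V bV [SV VS]] := coercive_inverse saS nt_gt0.
    by move=> x; rewrite rdotDl rdotZl rdotxx lerDr.
  apply: T_t; exists (fun x => - V x).
  have SE x : t%:C *: x - T x = - (T x + (- t)%:C *: x).
    by rewrite rmorphN scaleNr opprB.
  split=> [|x|x]; last 2 first.
  - by rewrite SE (linear_opN bV.1) opprK SV.
  - by rewrite scalerN (linear_opN linT) -opprD SE opprK VS.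
  have [K _ V_le] := bounded_opP bV.
  apply: (@bounded_op_continuous _ _ _ K) => [a x y|x]; last by rewrite hnorm_opp.
  by rewrite bV.1 opprD scalerN.
have Mt_gt0 : 0 < t - M by rewrite subr_gt0.
have saS := selfadjointD (selfadjointZ t (selfadjoint_id H)) (selfadjointZ (-1) saT).
have [|V bV [SV VS]] := coercive_inverse saS Mt_gt0.
  move=> x; rewrite rdotDl !rdotZl rdotxx mulN1r mulrBl lerD2l lerN2 expr2 mulrA.
  by rewrite (le_trans (ler_rdot _ _)) // ler_wpM2r ?hnorm_ge0.
by apply: T_t; exists V; split=> // x; [rewrite -[RHS]SV | rewrite -[RHS]VS];
  rewrite rmorphN scaleN1r.
Qed.

End Spectrum.

(** * Polynomial approximation on a segment *)

Section Weierstrass.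
Variable R : realType.

Lemma within_continuous_dist (f : R -> R) : {within `[0, +oo[, continuous f} ->
  forall x : R, 0 <= x -> forall e : R, 0 < e -> exists2 d : R, 0 < d &
    forall y : R, 0 <= y -> `|x - y| < d -> `|f x - f y| <= e.
Proof.
move=> /subspace_continuousP f_cont x x0 e e0.
have /cvgrPdist_le/(_ e e0) := f_cont x ltac:(by rewrite /= in_itv /= x0).
rewrite near_withinE => /nbhs_ballP[d /= d0 fd]; exists d => // y y0 xy.
by apply: fd => //=; rewrite in_itv /= y0.
Qed.

(** Compactness of a segment, for a property with a parameter that can be taken
    large: local validity implies validity everywhere. *)
Lemma segment_cover (M : R) (P : nat -> R -> Prop) :
  (forall x : R, 0 <= x <= M -> exists2 d : R, 0 < d & exists N, forall n y,
    (N <= n)%N -> 0 <= y <= M -> `|x - y| < d -> P n y) ->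
  exists n, forall x : R, 0 <= x <= M -> P n x.
Proof.
move=> Ploc.
have : compact `[0, M] by exact: segment_compact.
move=> /compact_near_coveringP/near_covering_withinP cov.
have [N _ NP] : \forall n \near \oo, forall x, `[0, M]%classic x -> P n x.
  apply: cov => x; rewrite /= in_itv /= => /Ploc[d d0 [N NP]].
  exists (ball x d, [set n | (N <= n)%N]); first split => /=.
  - exact: nbhsx_ballx.
  - exact: nbhs_infty_ge.
  by move=> [y n] /= [xy Nn]; rewrite in_itv /= => y0M; apply: NP.
by exists N => x xM; apply: (NP N) => //=; rewrite in_itv.
Qed.

(** Uniform continuity in the form that suits Bernstein polynomials, whose second
    moments are explicit ([bernstein_variance]). *)
Lemma quadratic_modulus (f : R -> R) (M e : R) : {within `[0, +oo[, continuous f} ->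
  0 < e -> exists n : nat, forall s t : R, 0 <= s <= M -> 0 <= t <= M ->
    `|f s - f t| <= e + n%:R * (s - t) ^+ 2.
Proof.
move=> /within_continuous_dist f_cont e0.
have [B fB] : exists B, forall x, 0 <= x <= M -> `|f x| <= B%:R.
  apply: (@segment_cover _ (fun n x => `|f x| <= n%:R)) => x /andP[x0 xM].
  have [d d0 fd] := f_cont x x0 1 ltr01.
  exists d => //; exists (Num.truncn (`|f x| + 1)).+1 => n y Nn /andP[y0 yM] xy.
  have := fd y y0 xy; have := lerB_dist (f y) (f x); rewrite distrC => le1 le2.
  have : `|f x| + 1 < n%:R.
    by rewrite (lt_le_trans (truncnS_gt _)) // ler_nat.
  by lra.
have [n nP] : exists n, forall s, 0 <= s <= M -> forall t, 0 <= t <= M ->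
    `|f s - f t| <= e + n%:R * (s - t) ^+ 2.
  apply: (@segment_cover _ (fun n s => forall t, 0 <= t <= M -> 
    `|f s - f t| <= e + n%:R * (s - t) ^+ 2)) => x /andP[x0 xM].
  have e2 : 0 < e / 2 by rewrite divr_gt0.
  have [d d0 fd] := f_cont x x0 _ e2.
  have d2 : 0 < d / 2 by rewrite divr_gt0.
  exists (d / 2) => //.
  exists (Num.truncn (B%:R * 2 / (d / 2) ^+ 2)).+1 => n s Nn s0M xs t t0M.
  have [xt|xt] := ltP `|x - t| d.
    have fxt := fd t (andP t0M).1 xt.
    have fxs : `|f x - f s| <= e / 2 by apply: fd (andP s0M).1 _; lra.
    rewrite (le_trans (ler_distD (f x) _ _)) // distrC.
    have : 0 <= n%:R * (s - t) ^+ 2 by rewrite mulr_ge0 ?sqr_ge0.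
    by lra.
  have st : d / 2 <= `|s - t|.
    by have := ler_distD s x t; lra.
  have : B%:R * 2 < n%:R * (d / 2) ^+ 2.
    rewrite -ltr_pdivrMr ?exprn_gt0 //.
    by rewrite (lt_le_trans (truncnS_gt _)) // ler_nat.
  have : n%:R * (d / 2) ^+ 2 <= n%:R * (s - t) ^+ 2.
    rewrite ler_wpM2l // -(real_normK (num_real (s - t))) ler_sqr ?nnegrE //.
    exact: ltW.
  have := ler_normB (f s) (f t); have := fB s s0M; have := fB t t0M.
  by lra.
by exists n => s t s0M t0M; exact: nP.
Qed.

(** The Bernstein polynomial of the values [f 0, ..., f n]: at [x], it is the mean of
    [f K], with [K] the number of successes in [n] independent trials of probability
    [x].  Conditioning on the first trial gives the recursion. *)
Fixpoint bernstein n (f : nat -> R) : {poly R} :=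
  if n is m.+1 then 'X * bernstein m (f \o S) + (1 - 'X) * bernstein m f
  else (f 0%N)%:P.

Lemma bernsteinS n f x : (bernstein n.+1 f).[x] =
  x * (bernstein n (f \o S)).[x] + (1 - x) * (bernstein n f).[x].
Proof. by rewrite /= !hornerE. Qed.

Lemma bernstein_le n f g x : 0 <= x <= 1 ->
  (forall k, (k <= n)%N -> f k <= g k) -> (bernstein n f).[x] <= (bernstein n g).[x].
Proof.
move=> /andP[x0 x1]; elim: n f g => [|n IH] f g fg; first by rewrite !hornerC fg.
rewrite !bernsteinS lerD ?ler_wpM2l ?subr_ge0 // IH // => k kn; apply: fg => //.
exact: ltnW.
Qed.

Lemma bernsteinD n f g x :
  (bernstein n (fun k => f k + g k)).[x] = (bernstein n f).[x] + (bernstein n g).[x].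
Proof.
elim: n f g => [|n IH] f g; first by rewrite !hornerC.
by rewrite !bernsteinS IH (IH (f \o S) (g \o S)); ring.
Qed.

Lemma bernsteinZ n (a : R) f x :
  (bernstein n (fun k => a * f k)).[x] = a * (bernstein n f).[x].
Proof.
elim: n f => [|n IH] f; first by rewrite !hornerC.
by rewrite !bernsteinS IH (IH (f \o S)); ring.
Qed.

Lemma bernstein_cst n (a : R) x : (bernstein n (fun=> a)).[x] = a.
Proof.
elim: n => [|n IH]; first by rewrite hornerC.
by rewrite !bernsteinS (_ : (fun=> a) \o S = fun=> a) // IH; ring.
Qed.

Lemma bernstein_variance n (c x : R) :
  (bernstein n (fun k => (k%:R - c) ^+ 2)).[x] = n%:R * x * (1 - x) + (n%:R * x - c) ^+ 2.
Proof.
elim: n c => [|n IH] c; first by rewrite hornerC; ring.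
rewrite bernsteinS.
have -> : (fun k => (k%:R - c) ^+ 2) \o S = fun k => (k%:R - (c - 1)) ^+ 2 :> R.
  by apply/funext => k /=; rewrite -natr1; ring.
by rewrite !IH -natr1; ring.
Qed.

Theorem weierstrass (f : R -> R) (M e : R) : {within `[0, +oo[, continuous f} ->
  0 < M -> 0 < e -> exists p : {poly R}, forall t : R, 0 <= t <= M -> `|f t - p.[t]| <= e.
Proof.
move=> f_cont M0 e0; have e2 : 0 < e / 2 by rewrite divr_gt0.
have [C fC] := quadratic_modulus M f_cont e2.
pose n := (Num.truncn (C%:R * M ^+ 2 / (e / 2))).+1.
(* the segment [0, M] is rescaled to [0, 1] *)
pose node k : R := M * (k%:R / n%:R).
exists (bernstein n (f \o node) \Po (M^-1 *: 'X)) => t t0M.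
rewrite horner_comp hornerZ hornerX; set x := M^-1 * t.
have tE : t = M * x by rewrite /x mulrA mulfV ?mul1r // gt_eqF.
have x01 : 0 <= x <= 1.
  by move: t0M; rewrite tE pmulr_rge0 // -{2}(mulr1 M) ler_pM2l.
have n_gt0 : 0 < n%:R :> R by rewrite ltr0n.
pose q k : R := e / 2 + (C%:R * (M / n%:R) ^+ 2) * (k%:R - n%:R * x) ^+ 2.
have qE : (bernstein n q).[x] <= e.
  rewrite (bernsteinD n (fun=> e / 2) (fun k => _ * (k%:R - n%:R * x) ^+ 2)).
  rewrite (bernsteinZ n _ (fun k => (k%:R - n%:R * x) ^+ 2)) bernstein_cst.
  rewrite bernstein_variance subrr expr0n addr0.
  have /ltW : C%:R * M ^+ 2 / (e / 2) < n%:R := truncnS_gt _.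
  rewrite ler_pdivrMr // => nC.
  have -> : C%:R * (M / n%:R) ^+ 2 * (n%:R * x * (1 - x)) =
      (C%:R * M ^+ 2) / n%:R * (x * (1 - x)) by field; rewrite gt_eqF.
  have CM : (C%:R * M ^+ 2) / n%:R <= e / 2 by rewrite ler_pdivrMr // (mulrC (e / 2)).
  have x1 : x * (1 - x) <= 1 by have := sqr_ge0 x; move/andP: x01 => [? ?]; nra.
  have CM0 : 0 <= (C%:R * M ^+ 2) / n%:R.
    by rewrite divr_ge0 ?mulr_ge0 ?sqr_ge0 // ltW.
  have := ler_wpM2l CM0 x1; lra.
have fq k : (k <= n)%N -> `|f t - f (node k)| <= q k.
  move=> kn; rewrite (le_trans (fC _ _ t0M _)) //.
    rewrite /node pmulr_rge0 // divr_ge0 //= ler_piMr ?(ltW M0) //.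
    by rewrite ler_pdivrMr // mul1r ler_nat.
  rewrite /q lerD2l -mulrA ler_wpM2l // -exprMn tE /node.
  suff -> : (M * x - M * (k%:R / n%:R)) ^+ 2 = (M / n%:R * (k%:R - n%:R * x)) ^+ 2 by [].
  by field; rewrite gt_eqF.
have := @bernstein_le n (fun k => f t + -1 * q k) (f \o node) x x01.
have := @bernstein_le n (f \o node) (fun k => f t + q k) x x01.
rewrite (bernsteinD n (fun=> f t) (fun k => -1 * q k)) (bernsteinD n (fun=> f t) q).
rewrite bernsteinZ bernstein_cst => ub lb.
rewrite ler_distl; apply/andP; split.
  rewrite lerBlDr (le_trans (ub _)) ?lerD2l // => k /fq /=.
  by rewrite ler_distlC => /andP[].
rewrite -lerBlDr; apply: le_trans (lb _); first by rewrite mulN1r lerD2l lerN2.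
by move=> k /fq /=; rewrite ler_distlC mulN1r => /andP[].
Qed.

End Weierstrass.

(** * Continuous functional calculus of a positive operator *)

Section PointwiseConvergence.
Variables (R : realType) (H : hilbert R).
Implicit Types (u v : nat -> H) (x y : H).

Lemma cvg_hnormP u x : u @ \oo --> x <->
  forall e : R, 0 < e -> \forall n \near \oo, hnorm (u n - x) <= e.
Proof.
split=> [/cvgrPdist_le ux e e0|ux].
  have := ux e%:C; rewrite ltcR => /(_ e0); apply: filterS => n.
  by rewrite hnormE lecR hdistC.
apply/cvgrPdist_le => e; rewrite ltcE /= => /andP[/eqP e_im e_gt0].
apply: filterS (ux _ e_gt0) => n un.
by rewrite hnormE lecE /= e_im eqxx hdistC.
Qed.

Lemma cvg_rdot u v x y : u @ \oo --> x -> v @ \oo --> y ->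
  rdot (u n) (v n) @[n --> \oo] --> rdot x y.
Proof.
move=> /cvg_hnormP ux /cvg_hnormP vy; apply/cvgrPdist_le => e e0.
pose K := hnorm x + hnorm y + 1.
have K_gt0 : 0 < K by rewrite ltr_wpDl // addr_ge0 ?hnorm_ge0.
pose d := Num.min 1 (e / K).
have d_gt0 : 0 < d by rewrite lt_min ltr01 divr_gt0.
have dK : d * K <= e by rewrite -ler_pdivlMr // ge_min lexx orbT.
near=> n.
have ud : hnorm (u n - x) <= d by near: n; exact: ux.
have vd : hnorm (v n - y) <= d by near: n; exact: vy.
have vy1 : hnorm (v n) <= 1 + hnorm y.
  rewrite -{1}(subrK y (v n)) (le_trans (ler_hnormD _ _)) // lerD2r.
  by rewrite (le_trans vd) // ge_min lexx.
have -> : rdot x y - rdot (u n) (v n) = - (rdot (u n - x) (v n) + rdot x (v n - y)).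
  by rewrite !rdotE; ring.
rewrite normrN (le_trans (ler_normD _ _)) // (le_trans _ dK) //.
have -> : d * K = d * (1 + hnorm y) + hnorm x * d by rewrite /K; ring.
rewrite lerD // (le_trans (ler_norm_rdot _ _)) //.
  by rewrite ler_pM ?hnorm_ge0.
by rewrite ler_wpM2l ?hnorm_ge0.
Unshelve. all: by end_near. Qed.

Lemma cvg_hilbert_unique u x y : u @ \oo --> x -> u @ \oo --> y -> x = y.
Proof. by move=> ux uy; apply: (cvg_unique (@norm_hausdorff _ H) ux uy). Qed.

Lemma cvg_bounded_op (T : H -> H) u x : bounded_op T -> u @ \oo --> x ->
  T (u n) @[n --> \oo] --> T x.
Proof. by move=> bT ux; apply: continuous_cvg => //; exact: bT.2. Qed.

Lemma cvg_real_unique (a : nat -> R) (s t : R) : a @ \oo --> s -> a @ \oo --> t -> s = t.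
Proof. by move=> a_s a_t; apply: (cvg_unique (@norm_hausdorff _ R) a_s a_t). Qed.

End PointwiseConvergence.

Section FunctionalCalculus.
Variables (R : realType) (H : hilbert R).
Implicit Types (T S : H -> H) (x y : H) (f g : R -> R) (p : nat -> {poly R}).

Lemma op_cvgP (S_ : nat -> H -> H) S : op_cvg S_ S <->
  forall e : R, 0 < e -> \forall n \near \oo, op_bound (fun x => S_ n x - S x) e.
Proof.
split=> SS e e0; apply: filterS (SS e e0) => n Sn x; have := Sn x.
  by rewrite !hnormE -rmorphM lecR.
by rewrite !hnormE -rmorphM lecR.
Qed.

Lemma uniform_cvgP (A : set R) p f :
  {uniform A, (fun n => horner (p n)) @ \oo --> f} <->
  forall e : R, 0 < e -> \forall n \near \oo, forall t, A t -> `|f t - (p n).[t]| < e.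
Proof.
split=> [pf e e0|pf P /uniform_nbhs[E [/= ]]].
  have := pf [set h | forall t, A t -> `|f t - h t| < e]; apply.
  apply/uniform_nbhs; exists [set ab | `|ab.1 - ab.2| < e]; split=> //.
  by rewrite -entourage_ballE; exists e => // -[a b] /=; rewrite -ball_normE.
rewrite -entourage_ballE => -[e /= e0 eE] EP.
apply: filterS (pf e e0) => n pn; apply: EP => t At.
by apply: eE; rewrite /= -ball_normE /=; exact: pn.
Qed.

(** [S] is a value of [f] at [T] in the sense of [cfc]. *)
Definition is_cfc f T S := bounded_op S /\ exists p,
  {uniform [set t : R | spectrum T t%:C], (fun n => horner (p n)) @ \oo --> f} /\
  op_cvg (fun n => poly_op (p n) T) S.

Lemma is_cfc_cfc f T S : is_cfc f T S -> is_cfc f T (cfc f T).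
Proof. by move=> fS; apply: (xgetPex 0); exists S. Qed.

(** Uniform approximation on the segment [[0, M]] rather than on the spectrum. *)
Definition approximates p f (M : R) := forall e : R, 0 < e ->
  \forall n \near \oo, forall t : R, 0 <= t <= M -> `|f t - (p n).[t]| <= e.

Lemma approximation_exists f (M : R) : 0 < M -> {within `[0, +oo[, continuous f} ->
  exists p, approximates p f M /\
    forall n t, 0 <= t <= M -> `|f t - (p n).[t]| <= n.+1%:R^-1.
Proof.
move=> M0 f_cont.
have /choice[p pf] : forall n : nat, exists q : {poly R}, forall t, 0 <= t <= M ->
    `|f t - q.[t]| <= n.+1%:R^-1.
  by move=> n; apply: weierstrass => //; rewrite invr_gt0.
exists p; split=> // e e0; have [N Ne] := natSinv_small e0.
by exists N => // n Nn t tM; rewrite (le_trans (pf n t tM)) // Ne.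
Qed.

Lemma poly_bounded (q : {poly R}) (M : R) : 0 <= M ->
  exists2 K : R, 0 <= K & forall t, 0 <= t <= M -> `|q.[t]| <= K.
Proof.
move=> M0; elim/poly_ind: q => [|q c [K K0 qK]].
  by exists 0 => // t _; rewrite horner0 normr0.
exists (K * M + `|c|); first by rewrite addr_ge0 ?mulr_ge0.
move=> t tM; rewrite hornerMXaddC (le_trans (ler_normD _ _)) // lerD2r normrM.
have /andP[t0 tM'] := tM.
by rewrite ler_pM // ?qK // ger0_norm.
Qed.

Lemma op_cvg_cvg (S_ : nat -> H -> H) S x : op_cvg S_ S -> S_ n x @[n --> \oo] --> S x.
Proof.
move=> /op_cvgP SS; apply/cvg_hnormP => e e0.
have K_gt0 : 0 < hnorm x + 1 by rewrite ltr_wpDl ?hnorm_ge0.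
apply: filterS (SS _ (divr_gt0 e0 K_gt0)) => n /(_ x)/le_trans; apply.
rewrite mulrAC ler_pdivrMr // ler_pM2l //; lra.
Qed.

Section Positive.
Variables (T : H -> H) (M : R).
Hypotheses (M0 : 0 < M) (pT : positive_op T) (T_le : op_bound T M).

Lemma poly_op_bound_segment (q : {poly R}) (e : R) : 0 <= e ->
  (forall t, 0 <= t <= M -> `|q.[t]| <= e) -> op_bound (poly_op q T) e.
Proof.
move=> e0 qe; apply: poly_op_bound => // [|t /(spectrum_positive pT T_le)]; last exact: qe.
exact: pT.1.
Qed.

(** If [0 <= q <= K] on the segment, then [||K - q(T)|| <= K], hence [q(T)] is
    positive. *)
Lemma poly_op_ge0 (q : {poly R}) x : (forall t, 0 <= t <= M -> 0 <= q.[t]) ->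
  0 <= rdot (poly_op q T x) x.
Proof.
move=> q_ge0; have linT := pT.1.1.1.
have [K K0 qK] := poly_bounded q (ltW M0).
have := @poly_op_bound_segment (K%:P - q) K K0 _ x.
rewrite poly_opB // poly_opC => le1.
have {}le1 : hnorm (K%:C *: x - poly_op q T x) <= K * hnorm x.
  apply: le1 => t tM; have := q_ge0 t tM; have := qK t tM.
  by rewrite !hornerE ler_norml => /andP[_ qK'] q0; rewrite ger0_norm; lra.
have := ler_rdot (K%:C *: x - poly_op q T x) x.
rewrite !rdotE rdotxx.
by have := ler_wpM2r (hnorm_ge0 x) le1; rewrite expr2; lra.
Qed.

(** Uniformly convergent polynomials give a Cauchy sequence of operators. *)
Lemma op_limit_exists f p :
  (forall n t, 0 <= t <= M -> `|f t - (p n).[t]| <= n.+1%:R^-1) ->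
  exists2 S, bounded_op S & op_cvg (fun n => poly_op (p n) T) S.
Proof.
move=> pf; have linT := pT.1.1.1.
have pmn m n : (n <= m)%N -> op_bound (fun x => poly_op (p m) T x - poly_op (p n) T x)
    (2 * n.+1%:R^-1).
  move=> nm x; rewrite -poly_opB //; apply: poly_op_bound_segment => [|t tM].
    by rewrite mulr_ge0 // invr_ge0.
  rewrite !hornerE; have := pf m t tM; have := pf n t tM.
  have : m.+1%:R^-1 <= n.+1%:R^-1 :> R by rewrite lef_pV2 ?posrE // ler_nat.
  move: (m.+1%:R^-1) (n.+1%:R^-1) => dm dn; rewrite !ler_norml => ? /andP[? ?] /andP[? ?].
  by apply/andP; split; lra.
have /choice[S pS] : forall x, exists l : H, forall e : R, 0 < e ->
    exists N, forall n, (N <= n)%N -> hnorm (poly_op (p n) T x - l) <= e.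
  move=> x; apply: hilbert_complete => e e0.
  have K_gt0 : 0 < 2 * (hnorm x + 1) by rewrite mulr_gt0 // ltr_wpDl ?hnorm_ge0.
  have [N Ne] := natSinv_small (divr_gt0 e0 K_gt0).
  have close m n : (N <= n)%N -> (n <= m)%N ->
      hnorm (poly_op (p m) T x - poly_op (p n) T x) <= e.
    move=> Nn nm; rewrite (le_trans (pmn _ _ nm x)) //.
    have := Ne n Nn; rewrite ler_pdivlMr //; have := hnorm_ge0 x.
    have : 0 <= n.+1%:R^-1 :> R by rewrite invr_ge0.
    by move: (n.+1%:R^-1) => d; nra.
  exists N => m n Nm Nn; have [nm|/ltnW mn] := leqP n m; first exact: close.
  by rewrite hdistC; exact: close.
have Sn n : op_bound (fun x => poly_op (p n) T x - S x) (2 * n.+1%:R^-1).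
  move=> x; apply/ler_addgt0Pr => e e0; have [N Ne] := pS x e e0.
  apply: le_trans (ler_hdistD (poly_op (p (maxn N n)) T x) _ _) _.
  rewrite lerD ?Ne ?leq_maxl // hdistC; apply: pmn; exact: leq_maxr.
have pS_cvg : op_cvg (fun n => poly_op (p n) T) S.
  apply/op_cvgP => e e0; have [N Ne] := natSinv_small (divr_gt0 e0 (ltr0Sn R 1)).
  exists N => // n Nn x; rewrite (le_trans (Sn n x)) // ler_wpM2r ?hnorm_ge0 //.
  by rewrite mulrC -ler_pdivlMr // Ne.
have linS : linear S.
  move=> a x y.
  have Sz z := @op_cvg_cvg _ S z pS_cvg.
  apply: (@cvg_hilbert_unique _ _ _ _ _ (Sz (a *: x + y))).
  under eq_fun do rewrite (poly_op_linear _ linT).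
  exact: (cvgD (cvgZl_tmp (k := a) (Sz x)) (Sz y)).
exists S => //.
have [K _ p0K] := bounded_opP (selfadjoint_poly (p 0%N) pT.1).1.
apply: (@bounded_op_continuous _ _ _ (K + 2)) => // x.
rewrite -(hnorm_opp (S x)) -sub0r (le_trans (ler_hdistD (poly_op (p 0%N) T x) _ _)) //.
rewrite mulrDl lerD //; first by rewrite sub0r hnorm_opp.
by rewrite (le_trans (Sn 0%N x)) // invr1 mulr1.
Qed.

Lemma cfcP f : {within `[0, +oo[, continuous f} -> is_cfc f T (cfc f T).
Proof.
move=> f_cont; have [q [qf qf']] := approximation_exists M0 f_cont.
have [S bS qS] := op_limit_exists qf'.
apply: (@is_cfc_cfc _ _ S); split=> //; exists q; split=> //.
apply/uniform_cvgP => e e0; have e2 : 0 < e / 2 by rewrite divr_gt0.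
apply: filterS (qf _ e2) => n qn t /(spectrum_positive pT T_le)/qn/le_lt_trans; apply.
by rewrite ltr_pdivrMr // ltr_pMr // ltr1n.
Qed.

(** The definition only provides some sequence of polynomials; any other one that
    approximates [f] on the segment has the same limit. *)
Lemma cfc_cvg f p : {within `[0, +oo[, continuous f} -> approximates p f M ->
  op_cvg (fun n => poly_op (p n) T) (cfc f T).
Proof.
move=> f_cont pf; have linT := pT.1.1.1.
have [_ [q [/uniform_cvgP qf /op_cvgP qT]]] := cfcP f_cont.
apply/op_cvgP => e e0; have e3 : 0 < e / 3 by rewrite divr_gt0.
near=> n => x.
have -> : poly_op (p n) T x - cfc f T x =
    poly_op (p n - q n) T x + (poly_op (q n) T x - cfc f T x).
  by rewrite poly_opB // addrA subrK.
have -> : e = e / 3 + e / 3 + e / 3 by field.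
rewrite mulrDl (le_trans (ler_hnormD _ _)) // lerD //; last first.
  by move: x; near: n; exact: qT.
apply: poly_op_bound => [|| t tT]; [exact: pT.1| by rewrite addr_ge0 // ltW |].
have tM := spectrum_positive pT T_le tT.
rewrite !hornerE (le_trans (ler_distD (f t) _ _)) // lerD // ?(distrC (p n).[t]).
  by move: t tM {tT}; near: n; exact: pf.
by apply: ltW; move: t tT {tM}; near: n; exact: qf.
Unshelve. all: by end_near. Qed.

Lemma cfc_cvg_pt f p : {within `[0, +oo[, continuous f} -> approximates p f M ->
  forall x, poly_op (p n) T x @[n --> \oo] --> cfc f T x.
Proof. by move=> f_cont pf x; have := @op_cvg_cvg _ (cfc f T) x (cfc_cvg f_cont pf). Qed.
Arguments cfc_cvg_pt {f p} _ _ x.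

Lemma selfadjoint_cfc f : {within `[0, +oo[, continuous f} -> selfadjoint (cfc f T).
Proof.
move=> f_cont; split; first exact: (cfcP f_cont).1.
move=> x y; have [p [pf _]] := approximation_exists M0 f_cont.
have cx := cfc_cvg_pt f_cont pf x; have cy := cfc_cvg_pt f_cont pf y.
apply: cvg_real_unique (cvg_rdot cx (cvg_cst y)) _.
under eq_fun do rewrite (selfadjoint_poly _ pT.1).2.
exact: (cvg_rdot (cvg_cst x) cy).
Qed.

Lemma approximates_bounded p f : approximates p f M -> exists2 K : R, 0 <= K &
  forall t, 0 <= t <= M -> `|f t| <= K.
Proof.
move=> pf; have [N _ /(_ N (leqnn N)) pN] := pf 1 ltr01.
have [K K0 pK] := poly_bounded (p N) (ltW M0).
exists (1 + K); first by rewrite addr_ge0.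
move=> t tM; rewrite -(subrK (p N).[t] (f t)) (le_trans (ler_normD _ _)) //.
by rewrite lerD // ?pN // pK.
Qed.

Lemma approximatesM p q f g : approximates p f M -> approximates q g M ->
  approximates (fun n => p n * q n) (fun t => f t * g t) M.
Proof.
move=> pf qg e e0.
have [K K0 fK] := approximates_bounded pf; have [L L0 gL] := approximates_bounded qg.
have B_gt0 : 0 < K + L + 1 by rewrite ltr_wpDl // addr_ge0.
pose d := Num.min 1 (e / (K + L + 1)).
have d_gt0 : 0 < d by rewrite lt_min ltr01 divr_gt0.
have dB : d * (K + L + 1) <= e by rewrite -ler_pdivlMr // ge_min lexx orbT.
have d1 : d <= 1 by rewrite ge_min lexx.
near=> n.
have pd : forall t, 0 <= t <= M -> `|f t - (p n).[t]| <= d by near: n; exact: pf.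
have qd : forall t, 0 <= t <= M -> `|g t - (q n).[t]| <= d by near: n; exact: qg.
move=> t tM; have {}pd := pd t tM; have {}qd := qd t tM.
have fK' := fK t tM; have gL' := gL t tM.
have -> : f t * g t - (p n * q n).[t] = f t * (g t - (q n).[t]) +
    (f t - (p n).[t]) * g t - (f t - (p n).[t]) * (g t - (q n).[t]).
  by rewrite hornerM; ring.
apply: le_trans (ler_normB _ _) _; apply: le_trans (lerD (ler_normD _ _) (lexx _)) _.
rewrite !normrM (le_trans _ dB) //.
have -> : d * (K + L + 1) = K * d + d * L + d * 1 by ring.
by rewrite !lerD // ler_pM // (le_trans qd).
Unshelve. all: by end_near. Qed.

Lemma cfcM f g (k : R -> R) x : {within `[0, +oo[, continuous f} ->
  {within `[0, +oo[, continuous g} -> {within `[0, +oo[, continuous k} ->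
  (forall t, 0 <= t -> f t * g t = k t) -> cfc f T (cfc g T x) = cfc k T x.
Proof.
move=> f_cont g_cont k_cont fgk; have linT := pT.1.1.1.
have [p [pf _]] := approximation_exists M0 f_cont.
have [q [qg _]] := approximation_exists M0 g_cont.
have pqk : approximates (fun n => p n * q n) k M.
  move=> e e0; apply: filterS (approximatesM pf qg e0) => n pqn t tM.
  by rewrite -fgk ?pqn // (andP tM).1.
apply: rdot_inj => y; rewrite (selfadjoint_cfc f_cont).2.
have cx := cfc_cvg_pt g_cont qg x; have cy := cfc_cvg_pt f_cont pf y.
apply: cvg_real_unique (cvg_rdot cx cy) _.
under eq_fun do rewrite -(selfadjoint_poly _ pT.1).2 -poly_opM //.
exact: (cvg_rdot (cfc_cvg_pt k_cont pqk x) (cvg_cst y)).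
Qed.

Lemma continuous_id_within : {within `[0, +oo[, continuous (@id R)}.
Proof. by apply: continuous_subspaceT => t; exact: cvg_id. Qed.

Lemma cfc_id x : cfc id T x = T x.
Proof.
have Xid : approximates (fun=> 'X) id M.
  by move=> e e0; near=> n => t _; rewrite hornerX subrr normr0 ltW.
apply: cvg_hilbert_unique (cfc_cvg_pt continuous_id_within Xid x) _.
by rewrite (poly_opX _ pT.1.1.1); exact: cvg_cst.
Unshelve. all: by end_near. Qed.

(** An affine minorant of [f] passes to quadratic forms: it is a minorant, up to
    [d], of the polynomials approximating [f]. *)
Lemma cfc_affine_le f (a b : R) x : {within `[0, +oo[, continuous f} ->
  (forall t, 0 <= t -> a + b * t <= f t) ->
  a * hnorm x ^+ 2 + b * rdot (T x) x <= rdot (cfc f T x) x.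
Proof.
move=> f_cont f_ge; have linT := pT.1.1.1.
have [p [pf _]] := approximation_exists M0 f_cont.
apply/ler_addgt0Pr => e e0.
have K_gt0 : 0 < hnorm x ^+ 2 + 1 by rewrite ltr_wpDl ?sqr_ge0.
pose d := e / (hnorm x ^+ 2 + 1).
have d_gt0 : 0 < d by rewrite divr_gt0.
have dK : d * hnorm x ^+ 2 <= e.
  by rewrite /d mulrAC ler_pdivrMr // ler_pM2l // lerDl.
apply: le_trans (_ : rdot (cfc f T x) x + d * hnorm x ^+ 2 <= _); last by rewrite lerD2l.
rewrite -lerBlDr; apply: (cvgr_to_ge (cvg_rdot (cfc_cvg_pt f_cont pf x) (cvg_cst x))).
near=> n.
have : 0 <= rdot (poly_op (p n - (a - d)%:P - b *: 'X) T x) x.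
  apply: poly_op_ge0 => t tM; rewrite !hornerE.
  have : `|f t - (p n).[t]| <= d by move: t tM; near: n; exact: pf.
  by rewrite ler_norml => /andP[_]; have := f_ge t (andP tM).1; lra.
rewrite !poly_opB // poly_opC poly_opZ // poly_opX // !rdotE rdotxx; lra.
Unshelve. all: by end_near. Qed.

Lemma cfc_ge0 f : {within `[0, +oo[, continuous f} ->
  (forall t, 0 <= t -> 0 <= f t) -> positive_op (cfc f T).
Proof.
move=> f_cont f_ge0; split; first exact: selfadjoint_cfc.
move=> x; have := @cfc_affine_le f 0 0 x f_cont; rewrite !mul0r addr0; apply.
by move=> t t0; rewrite mul0r addr0 f_ge0.
Qed.

End Positive.
Arguments cfc_cvg_pt {T M} _ _ _ {f p} _ _ x.

Lemma cfc_intertwine f (A S T : H -> H) (M : R) x : 0 < M -> bounded_op A ->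
  positive_op S -> op_bound S M -> positive_op T -> op_bound T M ->
  {within `[0, +oo[, continuous f} -> (forall y, A (S y) = T (A y)) ->
  A (cfc f S x) = cfc f T (A x).
Proof.
move=> M0 bA pS S_le pT T_le f_cont AS.
have [p [pf _]] := approximation_exists M0 f_cont.
have cx := cvg_bounded_op bA (cfc_cvg_pt M0 pS S_le f_cont pf x).
apply: cvg_hilbert_unique cx _.
under eq_fun do rewrite (poly_op_intertwine _ bA.1 pS.1.1.1 pT.1.1.1 AS).
exact: (cfc_cvg_pt M0 pT T_le f_cont pf (A x)).
Qed.

End FunctionalCalculus.

(** * Orlicz functions and the operator Jensen inequality *)

Section Orlicz.
Variables (R : realType) (phi : R -> R).
Hypothesis phiO : orlicz phi.

Lemma orlicz_conv (t x y : R) : 0 <= t <= 1 -> 0 <= x -> 0 <= y ->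
  phi (t * x + (1 - t) * y) <= t * phi x + (1 - t) * phi y.
Proof.
move=> /andP[t0 t1] x0 y0.
have := (orlicz_convex phiO) (Itv01 t0 t1) x y.
by rewrite !inE /= !in_itv /= x0 y0 => /(_ isT isT); rewrite !convRE.
Qed.

Lemma orlicz_midpoint (x y : R) : 0 <= x -> 0 <= y ->
  phi ((x + y) / 2) <= (phi x + phi y) / 2.
Proof.
move=> x0 y0; have := @orlicz_conv 2^-1 x y; rewrite invr_ge0 invf_le1 // ler1n ler0n.
have -> : 2^-1 * x + (1 - 2^-1) * y = (x + y) / 2 by field.
by move=> /(_ isT x0 y0) /le_trans; apply; lra.
Qed.

Lemma orlicz_slopes (r s t : R) : 0 <= r -> r < s -> s < t ->
  (phi s - phi r) / (s - r) <= (phi t - phi s) / (t - s).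
Proof.
move=> r0 rs st.
have sr_gt0 : 0 < s - r by rewrite subr_gt0.
have ts_gt0 : 0 < t - s by rewrite subr_gt0.
have tr_gt0 : 0 < t - r by rewrite subr_gt0 (lt_trans rs).
rewrite ler_pdivrMr // mulrAC ler_pdivlMr //.
have := @orlicz_conv ((t - s) / (t - r)) r t.
have -> : 0 <= (t - s) / (t - r) <= 1.
  rewrite divr_ge0 ?(ltW ts_gt0) ?(ltW tr_gt0) //= ler_pdivrMr // mul1r.
  by rewrite lerD2l lerN2 ltW.
have -> : (t - s) / (t - r) * r + (1 - (t - s) / (t - r)) * t = s.
  by field; rewrite gt_eqF.
move=> /(_ isT r0 (le_trans (le_trans r0 (ltW rs)) (ltW st))).
have -> : (t - s) / (t - r) * phi r + (1 - (t - s) / (t - r)) * phi t =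
   ((t - s) * phi r + (s - r) * phi t) / (t - r) by field; rewrite gt_eqF.
rewrite ler_pdivlMr //; lra.
Qed.

(** Supporting line; its slope is the left derivative of [phi], except at [0] where
    [phi] vanishes and the slope [0] will do because [phi] is nonnegative. *)
Lemma orlicz_support (s : R) : 0 <= s ->
  exists b : R, forall t, 0 <= t -> phi s + b * (t - s) <= phi t.
Proof.
rewrite le0r => /orP[/eqP ->|s0].
  by exists 0 => t t0; rewrite mul0r addr0 (orlicz0 phiO) (orlicz_ge0 phiO).
pose E := [set (phi s - phi r) / (s - r) | r in [set r | 0 <= r < s]].
have ubE t : s < t -> ubound E ((phi t - phi s) / (t - s)).
  by move=> st _ [r /andP[r0 rs] <-]; exact: orlicz_slopes.
have E_sup : has_sup E.
  split; first by exists ((phi s - phi 0) / (s - 0)), 0 => //=; rewrite lexx.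
  by exists ((phi (s + 1) - phi s) / (s + 1 - s)); apply: ubE; rewrite ltrDl.
exists (sup E) => t t0; have [ts|st|->] := ltgtP t s.
- have : (phi s - phi t) / (s - t) <= sup E.
    by apply: sup_upper_bound => //; exists t => //=; rewrite t0.
  by rewrite ler_pdivrMr ?subr_gt0 //; lra.
- have : sup E <= (phi t - phi s) / (t - s).
    by apply: sup_le_ub; [exact: E_sup.1 | exact: ubE].
  by rewrite ler_pdivlMr ?subr_gt0 //; lra.
- by rewrite subrr mulr0 addr0.
Qed.

Lemma orlicz_jensen (H : hilbert R) (T : H -> H) (x : H) : positive_op T ->
  hnorm x = 1 -> phi (rdot (T x) x) <= rdot (cfc phi T x) x.
Proof.
move=> pT x1; have [M M0 T_le] := bounded_opP pT.1.1.
have M1_gt0 : 0 < M + 1 by rewrite ltr_wpDl.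
have {}T_le : op_bound T (M + 1).
  by move=> y; rewrite (le_trans (T_le y)) // ler_wpM2r ?hnorm_ge0 // lerDl.
have [b phib] := orlicz_support (pT.2 x).
set s := rdot (T x) x in phib *.
have := @cfc_affine_le _ _ _ _ M1_gt0 pT T_le phi (phi s - b * s) b x
  (orlicz_continuous phiO).
rewrite x1 expr1n mulr1 subrK; apply => t t0.
by apply: le_trans (phib t t0); lra.
Qed.

End Orlicz.

(** * Modulus of an operator and mixed Schwarz inequality *)

Section Modulus.
Variables (R : realType) (H : hilbert R).
Implicit Types (A B S T : H -> H) (x y : H).

Lemma adjP A : bounded_op A -> is_adjoint A (adj A).
Proof. by move=> /adjoint_exists[B AB]; apply: (xgetPex 0); exists B. Qed.

Lemma rdot_adj A x y : bounded_op A -> rdot (A x) y = rdot x (adj A y).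
Proof. by move=> /adjP[_ AE]; rewrite /rdot AE. Qed.

Lemma adjK A : bounded_op A -> adj (adj A) = A.
Proof.
move=> bA; apply/funext => x; apply: rdot_inj => y.
by rewrite rdotC -rdot_adj 1?rdotC -?rdot_adj //; exact: (adjP bA).1.
Qed.

Lemma positive_adj_comp A : bounded_op A -> positive_op (adj A \o A).
Proof.
move=> bA; have [bA' _] := adjP bA.
have E x y : rdot ((adj A \o A) x) y = rdot (A x) (A y).
  by rewrite rdotC -rdot_adj // rdotC.
split; [split|] => [|x y|x].
- exact: bounded_op_comp.
- by rewrite E rdotC -E rdotC.
- by rewrite E rdotxx sqr_ge0.
Qed.

Lemma op_bound_le T (M N : R) : M <= N -> op_bound T M -> op_bound T N.
Proof. by move=> MN TM x; rewrite (le_trans (TM x)) // ler_wpM2r ?hnorm_ge0. Qed.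

Lemma common_bound S T : bounded_op S -> bounded_op T ->
  exists2 M : R, 0 < M & op_bound S M /\ op_bound T M.
Proof.
move=> /bounded_opP[M M0 SM] /bounded_opP[N N0 TN].
exists (M + N + 1); first by rewrite ltr_wpDl // addr_ge0.
split; [apply: op_bound_le SM | apply: op_bound_le TN]; lra.
Qed.

Lemma continuous_sqrt_within : {within `[0, +oo[, continuous (@Num.sqrt R)}.
Proof. by apply: continuous_subspaceT => t; exact: sqrt_continuous. Qed.

Lemma positive_abs A : bounded_op A -> positive_op (abs_op A).
Proof.
move=> bA; have pP := positive_adj_comp bA; have [M M0 [P_le _]] := common_bound pP.1.1 pP.1.1.
apply: (cfc_ge0 M0 pP P_le continuous_sqrt_within) => t _; exact: sqrtr_ge0.
Qed.

Lemma abs_op_sqr A x : bounded_op A -> abs_op A (abs_op A x) = adj A (A x).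
Proof.
move=> bA; have pP := positive_adj_comp bA; have [M M0 [P_le _]] := common_bound pP.1.1 pP.1.1.
rewrite -[RHS](cfc_id M0 pP P_le).
apply: (cfcM M0 pP P_le) => [|||t t0].
- exact: continuous_sqrt_within.
- exact: continuous_sqrt_within.
- exact: continuous_id_within.
- by rewrite -expr2 sqr_sqrtr.
Qed.

Lemma hnorm_abs A x : bounded_op A -> hnorm (abs_op A x) = hnorm (A x).
Proof.
move=> bA; apply/eqP; rewrite -(@eqrXn2 _ 2) ?hnorm_ge0 //; apply/eqP.
by rewrite -!rdotxx (positive_abs bA).1.2 abs_op_sqr // rdot_adj.
Qed.

Lemma abs_op_intertwine A x : bounded_op A -> A (abs_op A x) = abs_op (adj A) (A x).
Proof.
move=> bA; have bA' := (adjP bA).1.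
have pP := positive_adj_comp bA; have pQ := positive_adj_comp bA'.
have [M M0 [P_le Q_le]] := common_bound pP.1.1 pQ.1.1.
apply: (cfc_intertwine _ M0 bA pP P_le pQ Q_le continuous_sqrt_within) => y.
by rewrite /= adjK.
Qed.

Lemma positive_resolvent B (e : R) : positive_op B -> 0 < e ->
  exists2 V, bounded_op V & cancel (fun x => B x + e%:C *: x) V /\
    cancel V (fun x => B x + e%:C *: x).
Proof.
move=> [saB B_ge0] e0.
apply: (@coercive_inverse _ _ _ e _ e0) => [|x].
  exact: selfadjointD saB (selfadjointZ e (selfadjoint_id H)).
by rewrite rdotDl rdotZl rdotxx lerDr.
Qed.

(** Below, [V] and [W] are the inverses of [|A| + d] and [|A'| + d], where [A'] is
    the adjoint of [A], and [A V] is the contraction in place of the partial isometry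
    of the polar decomposition of [A]. *)
Lemma mixed_schwarz A (g h : R -> R) x y : bounded_op A ->
  {within `[0, +oo[, continuous g} -> {within `[0, +oo[, continuous h} ->
  (forall s, 0 <= s -> g s * h s = s) ->
  rdot (A x) y <= hnorm (cfc g (abs_op A) x) * hnorm (cfc h (abs_op (adj A)) y).
Proof.
move=> bA g_cont h_cont gh; have bA' := (adjP bA).1.
set B := abs_op A; set C := abs_op (adj A).
have pB : positive_op B := positive_abs bA; have pC : positive_op C := positive_abs bA'.
have [M M0 [B_le C_le]] := common_bound pB.1.1 pC.1.1.
have linA := bA.1; have linB := pB.1.1.1; have linC := pC.1.1.1.
have AB z : A (B z) = C (A z) := abs_op_intertwine z bA.
have AhB z := cfc_intertwine z M0 bA pB B_le pC C_le h_cont AB.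
have hgB z : cfc h B (cfc g B z) = B z.
  rewrite (cfcM M0 pB B_le z h_cont g_cont (@continuous_id_within R)).
    exact: cfc_id M0 pB B_le z.
  by move=> t t0; rewrite mulrC gh.
have saC := selfadjoint_cfc M0 pC C_le h_cont.
apply/ler_addgt0Pr => e e0.
have K_gt0 : 0 < hnorm x * hnorm y + 1 by rewrite ltr_wpDl // mulr_ge0 ?hnorm_ge0.
pose d := e / (hnorm x * hnorm y + 1).
have d_gt0 : 0 < d by rewrite divr_gt0.
have [V bV [BV VB]] := positive_resolvent pB d_gt0.
have [W bW [CW WC]] := positive_resolvent pC d_gt0.
have linV := bV.1; have linW := bW.1.
have AV z : A (V z) = W (A z).
  rewrite -[LHS]CW -[in RHS](VB z) (linear_opD linA) (linear_opZ _ linA) AB //.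
have WhC z : W (cfc h C z) = cfc h C (W z).
  rewrite -{1}(WC z) (linear_opD saC.1.1) (linear_opZ _ saC.1.1).
  by rewrite -(cfc_intertwine _ M0 pC.1.1 pC C_le pC C_le h_cont) // CW.
have AVh z : A (V (cfc h B z)) = cfc h C (A (V z)) by rewrite !AV AhB WhC.
have U_le z : hnorm (A (V z)) <= hnorm z.
  rewrite -hnorm_abs // -/B -ler_sqr ?nnegrE ?hnorm_ge0 // -{2}(VB z) hnormD_sqr.
  rewrite rdotZr -addrA lerDl addr_ge0 ?sqr_ge0 // mulr_ge0 //.
  by rewrite mulr_ge0 ?(ltW d_gt0) ?pB.2.
have -> : rdot (A x) y =
    rdot (A (V (cfc g B x))) (cfc h C y) + d * rdot (A (V x)) y.
  rewrite -saC.2 -AVh hgB -rdotZl -rdotDl -(linear_opZ _ linA) -(linear_opZ _ linV).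
  by rewrite -(linear_opD linA) -(linear_opD linV) BV.
rewrite lerD //.
  by rewrite (le_trans (ler_rdot _ _)) // ler_wpM2r ?hnorm_ge0.
apply: le_trans (_ : d * (hnorm x * hnorm y) <= e); last first.
  by rewrite /d mulrAC ler_pdivrMr // ler_pM2l // lerDl.
rewrite ler_wpM2l ?(ltW d_gt0) // (le_trans (ler_rdot _ _)) //.
by rewrite ler_wpM2r ?hnorm_ge0.
Qed.

End Modulus.

(** * The inequality at a unit vector *)

Lemma sqrM_le_pow4 (R : realType) (a b : R) : (a * b) ^+ 2 <= (a ^+ 4 + b ^+ 4) / 2.
Proof. by have := sqr_ge0 (a ^+ 2 - b ^+ 2); lra. Qed.

Lemma ler_half_sum (R : realType) (a b c d : R) : a <= c -> b <= d ->
  (a + b) / 2 <= (c + d) / 2.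
Proof. by lra. Qed.

Lemma ler_weighted (R : realType) (alpha v p q r : R) : 0 <= alpha -> alpha <= 1 ->
  v <= (p + q) / 2 -> v <= r -> v <= alpha / 2 * (p + q) + (1 - alpha) * r.
Proof.
move=> alpha0 alpha1 v_pq v_r.
have -> : v = alpha * v + (1 - alpha) * v by ring.
by rewrite mulrAC -mulrA lerD // ler_wpM2l // subr_ge0.
Qed.

Lemma rdot_combination (R : realType) (H : hilbert R) (a b : R) (S T U : H -> H) (x : H) :
  rdot ((a%:C *: (S + T) + b%:C *: U) x) x =
    a * (rdot (S x) x + rdot (T x) x) + b * rdot (U x) x.
Proof. by rewrite !fctE !rdotE. Qed.

Section IteratedOperators.
Variables (R : realType) (H : hilbert R).
Implicit Types (T : H -> H) (x : H).

Lemma positive_sqr T : selfadjoint T -> positive_op (iter 2 T).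
Proof.
move=> [bT symT]; split; [split|] => [|x y|x] /=.
- exact: (bounded_op_comp bT bT).
- by rewrite !symT.
- by rewrite symT rdotxx sqr_ge0.
Qed.

Lemma positive_pow4 T : selfadjoint T -> positive_op (iter 4 T).
Proof. by move=> /positive_sqr[saT _]; exact: positive_sqr saT. Qed.

(** For a unit vector, [||T x||^2 = <x, T^2 x> <= ||T^2 x||]. *)
Lemma hnorm_pow4 T x : selfadjoint T -> hnorm x = 1 ->
  hnorm (T x) ^+ 4 <= rdot (iter 4 T x) x.
Proof.
move=> [bT symT] x1; rewrite /= 2!symT rdotxx (exprM _ 2 2).
rewrite ler_sqr ?nnegrE ?sqr_ge0 ?hnorm_ge0 // -rdotxx symT.
by rewrite (le_trans (ler_rdot _ _)) // x1 mul1r.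
Qed.

End IteratedOperators.

Section UnitVector.
Variables (R : realType) (H : hilbert R) (A : H -> H) (g h phi : R -> R) (alpha : R).
Hypotheses (bA : bounded_op A).
Hypotheses (g_cont : {within `[0, +oo[, continuous g})
  (h_cont : {within `[0, +oo[, continuous h})
  (gh : forall s : R, 0 <= s -> g s * h s = s) (phiO : orlicz phi).
Hypotheses (alpha0 : 0 <= alpha) (alpha1 : alpha <= 1).

(** The operator whose Berezin number bounds [phi (ber A ^+ 2)]. *)
Definition upper_op : H -> H :=
  (alpha / 2)%:C *: (cfc phi (iter 4 (cfc g (abs_op A))) +
                     cfc phi (iter 4 (cfc h (abs_op (adj A))))) +
  (1 - alpha)%:C *: cfc phi (iter 2 (abs_op A)).

Lemma selfadjoint_cfc_positive (f : R -> R) (T : H -> H) : {within `[0, +oo[, continuous f} ->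
  positive_op T -> selfadjoint (cfc f T).
Proof.
move=> f_cont pT; have [M M0 [T_le _]] := common_bound pT.1.1 pT.1.1.
exact: (selfadjoint_cfc M0 pT T_le f_cont).
Qed.

Let sag : selfadjoint (cfc g (abs_op A)).
Proof. by apply: selfadjoint_cfc_positive => //; exact: positive_abs. Qed.

Let sah : selfadjoint (cfc h (abs_op (adj A))).
Proof.
by apply: selfadjoint_cfc_positive => //; apply: positive_abs; exact: (adjP bA).1.
Qed.

Let phi_cont := orlicz_continuous phiO.

Lemma selfadjoint_upper_op : selfadjoint upper_op.
Proof.
apply: selfadjointD; last first.
  apply: selfadjointZ; apply: selfadjoint_cfc_positive => //.
  by apply: positive_sqr; exact: (positive_abs bA).1.
apply: selfadjointZ; apply: selfadjointD; apply: selfadjoint_cfc_positive => //;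
  exact: positive_pow4.
Qed.

Lemma normc_ip_mixed (x : H) : hnorm x = 1 ->
  Normc.normc (ip H (A x) x) <=
    hnorm (cfc g (abs_op A) x) * hnorm (cfc h (abs_op (adj A)) x).
Proof.
move=> x1; set a := ip H (A x) x.
have [->|a0] := eqVneq (Normc.normc a) 0; first by rewrite mulr_ge0 ?hnorm_ge0.
have a_gt0 : 0 < Normc.normc a by rewrite lt_neqAle eq_sym a0 normc_ge0.
rewrite -(ler_pM2l a_gt0) -expr2 normc_ip -(linear_opZ _ bA.1).
rewrite (le_trans (mixed_schwarz _ _ bA g_cont h_cont gh)) //.
by rewrite (linear_opZ _ sag.1.1) hnormZ normc_conj mulrA.
Qed.

Lemma orlicz_unit_vector (x : H) : hnorm x = 1 ->
  phi (Normc.normc (ip H (A x) x) ^+ 2) <= rdot (upper_op x) x.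
Proof.
move=> x1; set v := Normc.normc _.
have v0 : 0 <= v := normc_ge0 _.
have v_gh := normc_ip_mixed x1; rewrite -/v in v_gh.
have v_A : v <= hnorm (A x) by rewrite (le_trans (ler_normc_ip _ _)) // x1 mulr1.
set G := cfc g (abs_op A) in v_gh *; set K := cfc h (abs_op (adj A)) in v_gh *.
have pG : positive_op (iter 4 G) by exact: positive_pow4.
have pK : positive_op (iter 4 K) by exact: positive_pow4.
have pB : positive_op (iter 2 (abs_op A)) := positive_sqr (positive_abs bA).1.
have jG := orlicz_jensen phiO pG x1; have jK := orlicz_jensen phiO pK x1.
have jB := orlicz_jensen phiO pB x1.
have v2_0 : 0 <= v ^+ 2 := sqr_ge0 v.
have vB : v ^+ 2 <= rdot (iter 2 (abs_op A) x) x.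
  by rewrite /= (positive_abs bA).1.2 rdotxx hnorm_abs // ler_sqr ?nnegrE ?hnorm_ge0.
have vGK : v ^+ 2 <= (rdot (iter 4 G x) x + rdot (iter 4 K x) x) / 2.
  apply: le_trans (_ : (hnorm (G x) * hnorm (K x)) ^+ 2 <= _).
    by rewrite ler_sqr ?nnegrE ?mulr_ge0 ?hnorm_ge0.
  apply: le_trans (sqrM_le_pow4 _ _) _.
  exact: ler_half_sum (hnorm_pow4 sag x1) (hnorm_pow4 sah x1).
have le1 := le_trans (orlicz_increasing phiO v2_0 vB) jB.
have le2 : phi (v ^+ 2) <=
    (rdot (cfc phi (iter 4 G) x) x + rdot (cfc phi (iter 4 K) x) x) / 2.
  apply: le_trans (orlicz_increasing phiO v2_0 vGK) _.
  apply: le_trans (orlicz_midpoint phiO (pG.2 x) (pK.2 x)) _.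
  exact: ler_half_sum jG jK.
rewrite /upper_op rdot_combination.
exact: (ler_weighted alpha0 alpha1 le2 le1).
Qed.

End UnitVector.

(** * Berezin numbers *)

Section BerezinNumber.
Variables (R : realType) (Omega : Type) (H : rkhs R Omega).
Hypotheses (Omega_neq0 : inhabited Omega) (kernel_neq0 : forall l : Omega, rkernel H l != 0).
Implicit Types (A : H -> H) (l : Omega).

Lemma hnorm_nrkernel l : hnorm (nrkernel H l) = 1.
Proof.
rewrite /hnorm /nrkernel normrZ normfV normr_id mulVf //.
by rewrite normr_eq0.
Qed.

(** Modulus of the Berezin symbol of [A] at [l]. *)
Definition berezin A l : R := Normc.normc (ip H (A (nrkernel H l)) (nrkernel H l)).

Lemma berezin_has_sup A : bounded_op A -> has_sup [set berezin A l | l in [set: Omega]].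
Proof.
move=> bA; split; first by case: Omega_neq0 => l; exists (berezin A l), l.
have [M _ A_le] := bounded_opP bA; exists M => _ [l _ <-].
rewrite (le_trans (ler_normc_ip _ _)) // hnorm_nrkernel mulr1 (le_trans (A_le _)) //.
by rewrite hnorm_nrkernel mulr1.
Qed.

Lemma berezin_le_ber A l : bounded_op A -> berezin A l <= ber A.
Proof. by move=> /berezin_has_sup A_sup; apply: sup_upper_bound => //; exists l. Qed.

Lemma ber_adj A : bounded_op A -> ber (adj A) = ber A.
Proof.
move=> bA; rewrite /ber; congr (sup (image _ _)); apply/funext => l.
by rewrite ipC normc_conj -(adjP bA).2.
Qed.

(** By continuity of [phi], it suffices to bound it at the squares of the values of
    the symbol. *)
Lemma orlicz_ber_le (phi : R -> R) A (r : R) : orlicz phi -> bounded_op A ->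
  (forall l, phi (berezin A l ^+ 2) <= r) -> phi (ber A ^+ 2) <= r.
Proof.
move=> phiO bA phi_le; have A_sup := berezin_has_sup bA.
have ber0 : 0 <= ber A.
  by case: Omega_neq0 => l; rewrite (le_trans _ (berezin_le_ber l bA)) // normc_ge0.
apply/ler_addgt0Pr => e e0.
have [d d0 phid] := within_continuous_dist (orlicz_continuous phiO) (sqr_ge0 (ber A)) e0.
have K_gt0 : 0 < 2 * ber A + 1 by rewrite ltr_wpDl // mulr_ge0.
have [_ [l _ <-]] := sup_adherent (divr_gt0 d0 K_gt0) A_sup.
rewrite -/(ber A) ltrBlDr -ltrBlDl ltr_pdivlMr // => lt_d.
have le_ber := berezin_le_ber l bA; have v0 : 0 <= berezin A l := normc_ge0 _.
have := phid _ (sqr_ge0 (berezin A l)).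
rewrite ger0_norm ?subr_ge0 ?ler_sqr ?nnegrE // => /(_ _)/wrap[].
  by rewrite subr_sqr; nra.
rewrite ler_norml => /andP[_]; have := phi_le l; lra.
Qed.

Lemma orlicz_ber (A : H -> H) (g h phi : R -> R) (alpha : R) : bounded_op A ->
  {within `[0, +oo[, continuous g} -> {within `[0, +oo[, continuous h} ->
  (forall s : R, 0 <= s -> g s * h s = s) -> orlicz phi ->
  0 <= alpha -> alpha <= 1 -> phi (ber A ^+ 2) <= ber (upper_op A g h phi alpha).
Proof.
move=> bA g_cont h_cont gh phiO alpha0 alpha1.
apply: orlicz_ber_le => // l.
have bU := (selfadjoint_upper_op alpha bA g_cont h_cont phiO).1.
apply: le_trans (berezin_le_ber l bU); apply: le_trans (rdot_le_normc _ _).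
by apply: orlicz_unit_vector => //; exact: hnorm_nrkernel.
Qed.

End BerezinNumber.

Theorem theorem3p11 (R : realType) (Omega : Type) (Omega_neq0 : inhabited Omega)
    (H : rkhs R Omega) (kernel_neq0 : forall l : Omega, rkernel H l != 0)
    (A : H -> H) (A_bounded : bounded_op A) (g h : R -> R)
    (g_ge0 : forall s : R, 0 <= s -> 0 <= g s)
    (h_ge0 : forall s : R, 0 <= s -> 0 <= h s)
    (g_continuous : {within `[0, +oo[, continuous g})
    (h_continuous : {within `[0, +oo[, continuous h})
    (ghE : forall s : R, 0 <= s -> g s * h s = s)
    (phi : R -> R) (phi_orlicz : orlicz phi)
    (alpha : R) (alpha_ge0 : 0 <= alpha) (alpha_le1 : alpha <= 1) :
  phi (ber A ^+ 2) <=
    ber ((alpha / 2)%:C *: (cfc phi (iter 4 (cfc g (abs_op A))) +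
                            cfc phi (iter 4 (cfc h (abs_op (adj A))))) +
         (1 - alpha)%:C *: cfc phi (iter 2 (abs_op A))) /\
  phi (ber A ^+ 2) <=
    ber ((alpha / 2)%:C *: (cfc phi (iter 4 (cfc g (abs_op (adj A)))) +
                            cfc phi (iter 4 (cfc h (abs_op A)))) +
         (1 - alpha)%:C *: cfc phi (iter 2 (abs_op (adj A)))).
Proof.
have bA' := (adjP A_bounded).1; split; first exact: orlicz_ber.
rewrite -(ber_adj A_bounded) -{3}(adjK A_bounded).
exact: (orlicz_ber Omega_neq0 kernel_neq0 bA' g_continuous h_continuous ghE).
Qed.
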